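(* Suppose that $V$ is a conformal vertex algebra such that $V_1$ consists of quasiprimary vectors (i.e. $L_1V_1=0$). Let $\phi$ be a conjugate linear involution of $V$ and let $g(a)=e^{-\pi\sqrt{-1}(\Delta_a+\frac12 p(a))}\phi(a)$. Then there exists a unique $\phi$-invariant Hermitian form $(\cdot,\cdot)$ on $V$ such that $(\mathbf 1,\mathbf 1)=1$. Moreover, for any collection $\{U^i\mid i\in I\}$ of quasiprimary elements that strongly generate $V$ we have $$\left((U^{i_1}_{j_1})^{m_1}\cdots (U^{i_t}_{j_t})^{m_t}\mathbf 1,\,(U^{i'_1}_{j'_1})^{m'_1}\cdots (U^{i'_{r}}_{j'_{r}})^{m'_{r}}\mathbf 1\right)=\left\langle (g(U^{i_t})_{-j_t})^{m_t}\cdots(g(U^{i_1})_{-j_1})^{m_1}(U^{i'_1}_{j'_1})^{m_1'}\cdots (U^{i'_{r}}_{j'_{r}})^{m'_{r}}\mathbf 1\right\rangle .$$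
   Context: Base field $\mathbb C$. A vertex algebra is a vector superspace $V$ with state-field correspondence $Y(a,z)=\sum_{n\in\mathbb Z}a_{(n)}z^{-n-1}$, vacuum $\mathbf 1$ and translation operator $T$ (i.e. a vertex superalgebra). $p(a)\in\{0,1\}\subset\mathbb Z$ is the parity. Conformal vertex algebra: there is a distinguished vector $L\in V_2$ with $Y(L,z)=\sum_n L_nz^{-n-2}$, $[L_m,L_n]=(m-n)L_{m+n}+\frac1{12}(m^3-m)\delta_{m+n,0}\,c\,I$, $L_{-1}=T$, $L_0$ diagonalizable with eigenspace decomposition $V=\bigoplus_{n\in\frac12\mathbb Z_{\ge0}}V_n$, $\dim V_n<\infty$, $V_0=\mathbb C\mathbf 1$. $\Delta_a$ is the $L_0$-eigenvalue of $a\in V_{\Delta_a}$, and for such $a$ one writes $Y(a,z)=\sum_{n\in-\Delta_a+\mathbb Z}a_nz^{-n-\Delta_a}$; the modes $U^i_j$ in the claim are of this type. An eigenvector $v$ of $L_0$ is quasiprimary if $L_1v=0$. A conjugate linear involution of $V$ is a parity preserving conjugate linear map $\phi:V\to V$ with $\phi^2=I$, $\phi(u_{(n)}v)=\phi(u)_{(n)}\phi(v)$ for all $n\in\mathbb Z$, and $\phi(L)=L$. Put $A(z)v=e^{zL_1}z^{-2L_0}g(v)$. A Hermitian form on $V$ is conjugate linear in the first and linear in the second argument, with $(v_1,v_2)=\overline{(v_2,v_1)}$. It is $\phi$-invariant if $(v,Y(a,z)u)=(Y(A(z)a,z^{-1})v,u)$ for all $a,u,v\in V$. A set $\{U^i\}$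 strongly generates $V$ if $V$ is spanned by the elements $U^{i_1}_{(-n_1)}\cdots U^{i_s}_{(-n_s)}\mathbf 1$ with $s\ge0$, $n_j\ge1$. The expectation value $\langle v\rangle\in\mathbb C$ of $v\in V$ is defined by $P_{V_0}(v)=\langle v\rangle\mathbf 1$, with $P_{V_0}$ the projection of $V=V_0\oplus\bigoplus_{n\ne0}V_n$ onto $V_0$. *)

(* Defs.v *)
From HB Require Import structures.
From mathcomp Require Import all_boot all_order all_algebra.
From mathcomp Require Import complex.
From mathcomp Require Import all_classical all_reals all_analysis.
Set Implicit Arguments.
Unset Strict Implicit.
Unset Printing Implicit Defensive.
Import Order.TTheory GRing.Theory Num.Theory.
Local Open Scope classical_set_scope.
Local Open Scope ring_scope.

Definition cexp (R : realType) (z : R[i]) : R[i] :=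
  Complex (expR (complex.Re z) * cos (complex.Im z))
          (expR (complex.Re z) * sin (complex.Im z)).

Definition subspace (K : nzRingType) (V : lmodType K) (U : set V) : Prop :=
  U 0 /\ forall (c : K) u v, U u -> U v -> U (c *: u + v).

(** [decomposes U v f]: [f] is a finitely supported family of vectors
    [f i] in [U i] with sum [v]. *)
Definition decomposes (I : choiceType) (K : nzRingType) (V : lmodType K)
    (U : I -> set V) (v : V) (f : I -> V) : Prop :=
  [/\ forall i, U i (f i), finite_set [set i | f i != 0]
    & v = \sum_(i \in [set: I]) f i].

Definition direct_sum (I : choiceType) (K : nzRingType) (V : lmodType K)
    (U : I -> set V) : Prop :=
  forall v, exists! f : I -> V, decomposes U v f.

(** The component of [v] in [U i]; meaningful when [direct_sum U]. *)
Definition component (I : choiceType) (K : nzRingType) (V : lmodType K)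
    (U : I -> set V) (i : I) (v : V) : V :=
  xget 0 [set w | exists2 f : I -> V, decomposes U v f & w = f i].

(** Vertex (super)algebras over the complex numbers [R[i]]: [vprod a n b] is
    the n-th product, so that Y(a,z) b = \sum_n (vprod a n b) z^(-n-1). The
    even and odd parts are [vparity false] and [vparity true]. *)
Record vertexAlgebra (R : realType) (V : lmodType R[i]) := VertexAlgebra {
  vparity : bool -> set V;
  vprod : V -> int -> V -> V;
  vacuum : V;
  transl : {linear V -> V};
  vparity_subspace : forall p, subspace (vparity p);
  vparity_direct : direct_sum vparity;
  vprod_linearl : forall n b, linear (fun a => vprod a n b);
  vprod_linearr : forall a n, linear (vprod a n);
  vprod_field : forall a b, exists N : int, forall n, N <= n -> vprod a n b = 0;
  vprod_parity : forall p q a n b,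
    vparity p a -> vparity q b -> vparity (p (+) q) (vprod a n b);
  vacuum_even : vparity false vacuum;
  vacuum_left : forall n b, vprod vacuum n b = if n == -1 then b else 0;
  vacuum_right : forall a (n : int), 0 <= n -> vprod a n vacuum = 0;
  vacuum_create : forall a, vprod a (-1) vacuum = a;
  transl_vacuum : transl vacuum = 0;
  (* [T, Y(a,z)] = d/dz Y(a,z) *)
  transl_covariance : forall a n b,
    transl (vprod a n b) - vprod a n (transl b)
    = - n%:~R *: vprod a (n - 1) b;
  (* (z - w)^N [Y(a,z), Y(b,w)] = 0 for some N; this is the coefficient of
     z^(-m-1) w^(-n-1), the bracket being the supercommutator *)
  vprod_locality : forall p q a b, vparity p a -> vparity q b ->
    exists N : nat, forall (m n : int) v,
      \sum_(k < N.+1) ((-1) ^+ k * 'C(N, k)%:R) *: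
        (vprod a (m + (N - k)%:Z) (vprod b (n + k%:Z) v)
         - (-1) ^+ (p && q) *:
           vprod b (n + k%:Z) (vprod a (m + (N - k)%:Z) v)) = 0
}.

(** Y(L,z) = \sum_n L_n z^(-n-2). *)
Definition Lop (R : realType) (V : lmodType R[i]) (VA : vertexAlgebra V)
    (L : V) (n : int) : V -> V := vprod VA L (n + 1).

Definition eigenspaceL0 (R : realType) (V : lmodType R[i])
    (VA : vertexAlgebra V) (L : V) (n : rat) : set V :=
  [set v | Lop VA L 0 v = ratr n *: v].

(** The half-integer weights are enumerated by [d : nat] as d/2. *)
Definition halfq (d : nat) : rat := d%:R / 2.

Record conformalStructure (R : realType) (V : lmodType R[i])
    (VA : vertexAlgebra V) := ConformalStructure {
  confL : V;
  central_charge : R[i];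
  confL_even : vparity VA false confL;
  confL_weight : eigenspaceL0 VA confL 2 confL;
  virasoro : forall (m n : int) v,
    Lop VA confL m (Lop VA confL n v) - Lop VA confL n (Lop VA confL m v)
    = (m - n)%:~R *: Lop VA confL (m + n) v
      + ((m ^+ 3 - m)%:~R / 12 * (m + n == 0)%:R * central_charge) *: v;
  confL_transl : forall v, Lop VA confL (-1) v = transl VA v;
  weight_direct : direct_sum (fun d : nat => eigenspaceL0 VA confL (halfq d));
  weight_findim : forall d : nat, exists (k : nat) (e : 'I_k -> V),
    forall v, eigenspaceL0 VA confL (halfq d) v ->
      exists c : 'I_k -> R[i], v = \sum_(i < k) c i *: e i;
  vacuum_neq0 : vacuum VA != 0;
  weight0_vacuum : forall v,
    eigenspaceL0 VA confL 0 v <-> exists c : R[i], v = c *: vacuum VA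
}.

Definition Lmode (R : realType) (V : lmodType R[i]) (VA : vertexAlgebra V)
    (cs : conformalStructure VA) : int -> V -> V := Lop VA (confL cs).

Definition weight (R : realType) (V : lmodType R[i]) (VA : vertexAlgebra V)
    (cs : conformalStructure VA) (n : rat) : set V :=
  eigenspaceL0 VA (confL cs) n.

Definition weight_part (R : realType) (V : lmodType R[i])
    (VA : vertexAlgebra V) (cs : conformalStructure VA) (d : nat) : V -> V :=
  component (fun e : nat => weight cs (halfq e)) d.

Definition parity_part (R : realType) (V : lmodType R[i])
    (VA : vertexAlgebra V) (p : bool) : V -> V := component (vparity VA) p.

Definition quasiprimary (R : realType) (V : lmodType R[i])
    (VA : vertexAlgebra V) (cs : conformalStructure VA) (h : rat) (v : V)
    : Prop :=
  weight cs h v /\ Lmode cs 1 v = 0.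

(** The mode a_n of a vector [a] of weight [h], Y(a,z) = \sum_n a_n z^(-n-h);
    meaningful for [n + h] integral. *)
Definition mode (R : realType) (V : lmodType R[i]) (VA : vertexAlgebra V)
    (h : rat) (a : V) (n : rat) : V -> V :=
  vprod VA a (Num.floor (n + h) - 1).

Definition conj_linear (R : realType) (V W : lmodType R[i]) (f : V -> W)
    : Prop :=
  forall (c : R[i]) u v, f (c *: u + v) = c^* *: f u + f v.

Record conj_linear_involution (R : realType) (V : lmodType R[i])
    (VA : vertexAlgebra V) (cs : conformalStructure VA) (phi : V -> V)
    : Prop := ConjLinearInvolution {
  involution_conj_linear : conj_linear phi;
  involution_parity : forall p v, vparity VA p v -> vparity VA p (phi v);
  involutionK : involutive phi;
  involution_vprod : forall u n v,
    phi (vprod VA u n v) = vprod VA (phi u) n (phi v);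
  involution_confL : phi (confL cs) = confL cs
}.

(** g(a) = exp(- pi sqrt(-1) (Delta_a + p(a)/2)) phi(a) on vectors homogeneous
    for both the weight and the parity, extended additively. *)
Definition gmap (R : realType) (V : lmodType R[i]) (VA : vertexAlgebra V)
    (cs : conformalStructure VA) (phi : V -> V) (v : V) : V :=
  \sum_(d \in [set: nat]) \sum_(p : bool)
    cexp (- ((pi : R)%:C%C * 'i%C * (ratr (halfq d) + (p : nat)%:R / 2)))
      *: phi (parity_part VA p (weight_part cs d v)).

(** Coefficient of z^j in A(z) v = e^(z L_1) z^(-2 L_0) g(v): the term of
    L_1^k / k! on the component of g(v) of weight d/2 carries z^(k - d). *)
Definition Acoef (R : realType) (V : lmodType R[i]) (VA : vertexAlgebra V)
    (cs : conformalStructure VA) (phi : V -> V) (v : V) (j : int) : V :=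
  \sum_(x \in [set x : nat * nat | x.1%:Z - x.2%:Z = j])
    (x.1`!%:R)^-1 *:
      iter x.1 (Lmode cs 1) (weight_part cs x.2 (gmap cs phi v)).

(** Coefficient of z^m in Y(A(z) a, z^-1) v, where
    Y(b, z^-1) = \sum_n b_(n) z^(n+1). *)
Definition YAcoef (R : realType) (V : lmodType R[i]) (VA : vertexAlgebra V)
    (cs : conformalStructure VA) (phi : V -> V) (a v : V) (m : int) : V :=
  \sum_(j \in [set: int]) vprod VA (Acoef cs phi a j) (m - j - 1) v.

Definition hermitian_form (R : realType) (V : lmodType R[i])
    (B : V -> V -> R[i]) : Prop :=
  [/\ forall v, scalar (B v),
      forall w (c : R[i]) u v, B (c *: u + v) w = c^* * B u w + B v w
    & forall u v, B u v = (B v u)^*].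

(** (v, Y(a,z) u) = (Y(A(z) a, z^-1) v, u), compared at each power z^m of the
    formal variable (so z is not conjugated by the form). *)
Definition phi_invariant (R : realType) (V : lmodType R[i])
    (VA : vertexAlgebra V) (cs : conformalStructure VA) (phi : V -> V)
    (B : V -> V -> R[i]) : Prop :=
  forall a u v (m : int),
    B v (vprod VA a (- m - 1) u) = B (YAcoef cs phi a v m) u.

Definition strongly_generates (R : realType) (V : lmodType R[i])
    (VA : vertexAlgebra V) (I : Type) (U : I -> V) : Prop :=
  forall v, exists (k : nat) (c : 'I_k -> R[i]) (w : 'I_k -> seq (I * nat)),
    (forall l, all (fun x => 0 < x.2)%N (w l)) /\
    v = \sum_(l < k) c l *:
      foldr (fun x => vprod VA (U x.1) (- x.2%:Z)) (vacuum VA) (w l).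

Definition vev (R : realType) (V : lmodType R[i])
    (VA : vertexAlgebra V) (cs : conformalStructure VA) (v : V) : R[i] :=
  xget 0 [set c : R[i] | weight_part cs 0 v = c *: vacuum VA].

(** [word VA h U [:: (i_1, j_1, m_1); ...; (i_t, j_t, m_t)] v] is
    (U^(i_1)_(j_1))^(m_1) ... (U^(i_t)_(j_t))^(m_t) v, with modes taken with
    respect to the weights [h i] of the [U i]. *)
Definition word (R : realType) (V : lmodType R[i]) (VA : vertexAlgebra V)
    (I : Type) (h : I -> rat) (U : I -> V) (s : seq (I * rat * nat)) (v : V)
    : V :=
  foldr (fun x w => iter x.2 (mode VA (h x.1.1) (U x.1.1) x.1.2) w) v s.

Definition adjoint_word (I : Type) (s : seq (I * rat * nat))
    : seq (I * rat * nat) :=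
  rev [seq (x.1.1, - x.1.2, x.2) | x <- s].

Definition admissible (I : Type) (h : I -> rat) (s : seq (I * rat * nat))
    : bool :=
  all (fun x => x.1.2 + h x.1.1 \is a Num.int) s.

(* Main.v *)
(** Write a_(n)^* for the coefficient of Y(A(z)a, z^-1) that invariance forces
    to be the adjoint of a_(n).  Any normalized invariant form satisfies
    (1, w) = <w>, since L_0 is self-adjoint, hence (v, u) = <v_(-1)^* u>; this
    proves uniqueness and gives the formula for the form.  For existence take
    this as the definition.  Hermitian symmetry and invariance then reduce to
    the reflection identity
      <a_(m) b_(n) c_(k) 1> = conj <c_(k)^* b_(n)^* a_(m)^* 1>
    and its analogues with fewer letters.  As L_1 V_1 = 0, sl_2-theory makes V
    spanned by the T^k q with q quasiprimary, so a, b, c may be taken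
    quasiprimary.  If c has weight h > 0, either c_(k) kills the vacuum on the
    right and its adjoint kills the expectation value on the left, or the other
    way round; moving c_(k) to the left therefore leaves only commutators, that
    is shorter words.  What makes this work is that * reverses commutators of
    quasiprimary modes: by the sl_2-covariance of a_(j)b this is a
    Vandermonde-type identity. *)
Require Import Defs.
From HB Require Import structures.
From mathcomp Require Import all_boot all_order all_algebra.
From mathcomp Require Import complex.
From mathcomp Require Import all_classical all_reals all_analysis.
From mathcomp Require Import ring lra zify.
Set Implicit Arguments.
Unset Strict Implicit.
Unset Printing Implicit Defensive.
Import Order.TTheory GRing.Theory Num.Theory.
Local Open Scope classical_set_scope.
Local Open Scope ring_scope.

(** * Generalized binomial coefficients and finite differences *)

(** The only commutation axiom is locality, so the commutator formula for modes has to be derived: a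
    distribution killed by a power of z - w has a Newton expansion along each line m + n constant,
    and its coefficients are identified with modes of a_(j)b by Dong's lemma and Goddard's
    uniqueness argument. The shortening of words is shaped by the fact that a_(j)b need not be
    quasiprimary even if a and b are. Each reflection identity is therefore established for
    arbitrary vectors before the next length; the passage from q to T^k q works because a_(n) and
    its adjoint obey the same rule (T a)_(n) = - n a_(n-1), with a real coefficient. Three letters
    suffice since u = u_(-1) 1 and v = v_(-1) 1, so that invariance compares words in u, a and v
    only. The hypothesis L_1 V_1 = 0 acts a second time through <L_1 v> = 0, which makes creation
    modes vanish under the expectation value. The phases of g are powers of - i and g is an
    involution, so a mode of a quasiprimary vector is itself an adjoint. Weights are carried
    doubled, as natural numbers. *)

Lemma int_shift_ind (P : int -> Prop) :
  P 0 -> (forall x, P x -> P (x + 1)) -> (forall x, P (x + 1) -> P x) ->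
  forall x, P x.
Proof.
move=> P0 PS PP; elim=> // n IHn.
  by rewrite -addn1 PoszD; exact: PS.
by apply: PP; rewrite -addn1 PoszD opprD addrNK.
Qed.

Lemma subrACA (V : zmodType) (a b c d : V) :
  (a - b) - (c - d) = (a - c) - (b - d).
Proof. by rewrite !opprD addrACA. Qed.

Section GeneralizedBinomial.
Variable K : numFieldType.

Definition gbin (x : int) (k : nat) : K :=
  (\prod_(i < k) (x - i%:Z)%:~R) / k`!%:R.

Lemma gbin0 x : gbin x 0 = 1.
Proof. by rewrite /gbin big_ord0 fact0 divr1. Qed.

Lemma gbin0S k : gbin 0 k.+1 = 0.
Proof. by rewrite /gbin big_ord_recl subr0 !mul0r. Qed.

Lemma gbin1 x : gbin x 1 = x%:~R.
Proof. by rewrite /gbin big_ord_recl big_ord0 subr0 mulr1 divr1. Qed.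

Lemma gbinS x k : gbin (x + 1) k.+1 = gbin x k.+1 + gbin x k.
Proof.
rewrite /gbin big_ord_recl big_ord_recr /= subr0 factS natrM.
have -> : \prod_(i < k) (x + 1 - (bump 0 i)%:Z)%:~R
          = \prod_(i < k) (x - i%:Z)%:~R :> K.
  by apply: eq_bigr => i _; congr (_%:~R); rewrite /bump; lia.
have k0 : k`!%:R != 0 :> K by rewrite pnatr_eq0 -lt0n fact_gt0.
have k1 : k.+1%:R != 0 :> K by rewrite pnatr_eq0.
rewrite !intrD rmorphN /=; set P := \prod_(i < k) _.
have -> : (k%:Z)%:~R = k.+1%:R - 1 :> K by rewrite -natr1 addrK.
move: P k0 k1; move: (k.+1%:R : K) (k`!%:R : K) (x%:~R : K) => a b c P b0 a0.
by field; rewrite a0 b0.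
Qed.

(** Chu-Vandermonde, seen by writing C(y - j, l - j) as (-1)^(l - j) C(l - y - 1, l - j). The proof
    moves x by one in either direction: both sides satisfy F(x + 1, y, l) = F(x, y, l) - F(x, y - 1,
    l - 1). *)
Lemma gbin_vandermonde x y l :
  \sum_(j < l.+1) (-1) ^+ j * gbin x j * gbin (y - j%:Z) (l - j)
  = gbin (y - x) l.
Proof.
have shift z w m :
    \sum_(j < m.+1) (-1) ^+ j * gbin (z + 1) j * gbin (w - j%:Z) (m - j) =
    \sum_(j < m.+1) (-1) ^+ j * gbin z j * gbin (w - j%:Z) (m - j)
    - (if m is m'.+1 then
         \sum_(j < m'.+1) (-1) ^+ j * gbin z j * gbin (w - 1 - j%:Z) (m' - j)
       else 0).
  case: m => [|m]; first by rewrite !big_ord1 !gbin0 subr0.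
  rewrite big_ord_recl [in RHS]big_ord_recl !gbin0 -addrA; congr (_ + _).
  rewrite -sumrB; apply: eq_bigr => j _; rewrite /= /bump /= add1n gbinS subSS.
  rewrite exprS (_ : w - 1 - _ = w - j.+1%:Z); last by lia.
  ring.
have down w m : gbin (w - 1) m
    = gbin w m - (if m is m'.+1 then gbin (w - 1) m' else 0).
  case: m => [|m]; first by rewrite !gbin0 subr0.
  by rewrite -{2}(subrK 1 w) gbinS addrK.
elim/int_shift_ind: x y l => [y l|x IH y l|x IH y l].
- rewrite big_ord_recl /= gbin0 big1 ?addr0 ?subr0 ?subn0 ?mul1r //.
  by move=> i _; rewrite gbin0S mulr0 mul0r.
- rewrite shift IH (_ : y - (x + 1) = y - x - 1); last by lia.
  rewrite down; case: l => // l.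
  by rewrite IH addrAC.
(* Solving the recursion for the sum at x leaves another sum at x, of order l - 1, which an inner
   induction on l provides. *)
- elim: l y => [|l IHl] y.
    by rewrite big_ord1 !gbin0 expr0 !mulr1.
  have := shift x y l.+1; rewrite IH IHl => /(congr1 (fun t => t + gbin (y - 1 - x) l)).
  rewrite subrK => <-; rewrite (_ : y - (x + 1) = y - x - 1); last by lia.
  rewrite down (_ : y - 1 - x = y - x - 1); last by lia.
  by rewrite subrK.
Qed.

End GeneralizedBinomial.

(** Multiplication by [z - w] of the distribution with coefficients [f]. *)
Definition dif {V : zmodType} (f : int -> int -> V) (m n : int) : V :=
  f (m + 1) n - f m (n + 1).

Section FiniteDifferences.
Variables (K : numFieldType) (V : lmodType K).
Implicit Types f : int -> int -> V.

Lemma iter_difE N f m n :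
  iter N dif f m n = \sum_(k < N.+1) ((-1) ^+ k * 'C(N, k)%:R) *:
    f (m + (N - k)%:Z) (n + k%:Z).
Proof.
elim: N m n => [|N IH] m n.
  by rewrite big_ord1 /= subnn !addr0 mulr1 scale1r.
rewrite iterS {1}/dif !IH.
rewrite [RHS]big_ord_recl /= bin0 expr0 mulr1 scale1r subn0 addr0.
rewrite [X in X - _]big_ord_recl /= bin0 expr0 mulr1 scale1r subn0 addr0.
rewrite -addrA; congr (_ + _); first by congr f; lia.
under [in RHS]eq_bigr do rewrite /bump /= add1n binS natrD mulrDr scalerDl.
rewrite [RHS]big_split /=; congr (_ + _).
  rewrite [RHS]big_ord_recr /= bin_small // mulr0 scale0r addr0.
  apply: eq_bigr => i _; rewrite /bump /= add1n; congr (_ *: f _ _).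
  by have := ltn_ord i; lia.
rewrite -sumrN; apply: eq_bigr => i _; rewrite -scaleNr -mulNr exprS mulN1r.
by congr (_ *: f _ _); lia.
Qed.

(** [dif] is the forward difference in m along the lines m + n constant. If its N-th power vanishes,
    f is polynomial in m of degree below N on each line, and this is Newton's interpolation from m =
    0. *)
Lemma newton_expansion N f : (forall m n, iter N dif f m n = 0) ->
  forall m n, f m n =
    \sum_(j < N) gbin K m j *: iter j dif f 0 (m + n - j%:Z).
Proof.
elim: N f => [|N IH] f f0 m n; first by rewrite big_ord0; exact: f0.
have {}IH := IH (dif f) _; have {}IH := IH (fun m n => _).
have dE m' n' : dif f m' n' =
    \sum_(j < N) gbin K m' j *: iter j.+1 dif f 0 (m' + n' - j%:Z).
  rewrite IH; last by move=> a b; rewrite -iterSr; exact: f0.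
  by apply: eq_bigr => j _; rewrite -iterSr.
pose g m n := \sum_(j < N.+1) gbin K m j *: iter j dif f 0 (m + n - j%:Z).
have dgE m' n' : dif g m' n' = dif f m' n'.
  rewrite dE /dif /g -sumrB big_ord_recl /= !gbin0 !scale1r.
  rewrite (_ : m' + 1 + n' = m' + (n' + 1)); last by lia.
  rewrite subrr add0r; apply: eq_bigr => j _.
  rewrite /bump /= add1n gbinS -scalerBl addrAC subrr add0r.
  by congr (_ *: dif _ _ _); lia.
(* The candidate [g] has the same [dif] as [f] and the same values at m = 0; this determines it in
   both directions. *)
suff fg : forall m n, f m n = g m n by exact: fg.
elim/int_shift_ind => [k|x IHx k|x IHx k].
- rewrite /g big_ord_recl big1 ?gbin0 ?scale1r /=.
    by rewrite add0r subr0 addr0.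
  by move=> i _; rewrite /bump /= add1n gbin0S scale0r.
- by have := dgE x k; rewrite /dif IHx => /addIr.
- have := dgE x (k - 1); rewrite /dif subrK IHx => /addrI /oppr_inj.
  by move=> ->.
Qed.

End FiniteDifferences.

(** * Dong's lemma on mutual locality, for coefficients in three variables *)

Section Dong.
Variable V : zmodType.
Notation T3 := (int -> int -> int -> V).
Implicit Types F G : T3.

(** Multiplication by [z1 - z2], [z1 - z3] and [z2 - z3]. *)
Definition dif12 F : T3 := fun m n k => F (m + 1) n k - F m (n + 1) k.
Definition dif13 F : T3 := fun m n k => F (m + 1) n k - F m n (k + 1).
Definition dif23 F : T3 := fun m n k => F m (n + 1) k - F m n (k + 1).

Definition fun3_0 : T3 := fun _ _ _ => 0.

Lemma fun3P F G : (forall m n k, F m n k = G m n k) -> F = G.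
Proof. by move=> FG; do 3 (apply/funext => ?); exact: FG. Qed.

Lemma dif12_13 F : dif12 (dif13 F) = dif13 (dif12 F).
Proof. by apply: fun3P => m n k; rewrite /dif12 /dif13 subrACA. Qed.

Lemma dif12_23 F : dif12 (dif23 F) = dif23 (dif12 F).
Proof. by apply: fun3P => m n k; rewrite /dif12 /dif23 subrACA. Qed.

Lemma dif13_23 F : dif13 (dif23 F) = dif23 (dif13 F).
Proof. by apply: fun3P => m n k; rewrite /dif13 /dif23 subrACA. Qed.

Lemma dif23E F m n k : dif23 F m n k = dif13 F m n k - dif12 F m n k.
Proof. by rewrite /dif23 /dif13 /dif12 opprB [RHS]addrC addrA subrK. Qed.

Lemma iter_comm (T : Type) (f g : T -> T) (fg : forall x, f (g x) = g (f x))
  i j x : iter i f (iter j g x) = iter j g (iter i f x).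
Proof.
have fgj k y : f (iter k g y) = iter k g (f y).
  by elim: k => //= k IH; rewrite fg IH.
by elim: i => //= i ->; rewrite fgj.
Qed.

Lemma iter_fix (T : Type) (f : T -> T) x i : f x = x -> iter i f x = x.
Proof. by move=> fx; elim: i => //= i ->. Qed.

Lemma dif12_0 : dif12 fun3_0 = fun3_0.
Proof. by apply: fun3P => m n k; rewrite /dif12 subrr. Qed.

Lemma dif13_0 : dif13 fun3_0 = fun3_0.
Proof. by apply: fun3P => m n k; rewrite /dif13 subrr. Qed.

Lemma dif23_0 : dif23 fun3_0 = fun3_0.
Proof. by apply: fun3P => m n k; rewrite /dif23 subrr. Qed.

Lemma iter_dif23D i F G m n k :
  iter i dif23 (fun m n k => F m n k + G m n k) m n k
  = iter i dif23 F m n k + iter i dif23 G m n k.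
Proof.
elim: i m n k => //= i IH m n k.
by rewrite {1 2 3}/dif23 !IH opprD addrACA.
Qed.

Lemma iter_dif23B i F G m n k :
  iter i dif23 (fun m n k => F m n k - G m n k) m n k
  = iter i dif23 F m n k - iter i dif23 G m n k.
Proof.
elim: i m n k => //= i IH m n k.
by rewrite {1 2 3}/dif23 !IH subrACA.
Qed.

(** Each factor of [(z2 - z3)^(2N)], written as [((z1 - z3) - (z1 - z2))], is
    absorbed by a factor of [G]. *)
Lemma dif23_vanish N G :
  iter N dif12 G = fun3_0 -> iter N dif13 G = fun3_0 ->
  iter (N + N) dif23 G = fun3_0.
Proof.
move=> G12 G13.
suff H t i j : (N + N <= i + j + t)%N ->
    iter t dif23 (iter i dif12 (iter j dif13 G)) = fun3_0.
  by have := H (N + N)%N 0%N 0%N (leqnn _).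
elim: t i j => [|t IH] i j.
  rewrite addn0 => le_ij; have [le_Ni|lt_iN] := leqP N i.
    rewrite (iter_comm dif12_13) -(subnK le_Ni) iterD G12 /=.
    by rewrite !iter_fix ?dif12_0 ?dif13_0.
  rewrite -(subnK (_ : N <= j)%N) ?iterD; last by lia.
  by rewrite G13 /= !iter_fix ?dif12_0 ?dif13_0.
move=> le_ij; rewrite iterSr.
rewrite (_ : dif23 _ = fun m n k =>
  iter i dif12 (iter j.+1 dif13 G) m n k - iter i.+1 dif12 (iter j dif13 G) m n k); last first.
  apply: fun3P => m n k; rewrite dif23E -iterS.
  by rewrite [iter j.+1 _ _]iterS (iter_comm dif12_13 i 1).
apply: fun3P => m n k; rewrite iter_dif23B !IH ?subrr //; lia.
Qed.

(** After multiplication by (z2 - z3)^N only G is left. That product is killed by (z1 - z3)^N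
    because G is, and by (z1 - z2)^N because F + G is, so 2N further factors z2 - z3 annihilate
    it. *)
Lemma dong N F G :
  iter N dif12 (fun m n k => F m n k + G m n k) = fun3_0 ->
  iter N dif23 F = fun3_0 -> iter N dif13 G = fun3_0 ->
  iter (N + N + N) dif23 (fun m n k => F m n k + G m n k) = fun3_0.
Proof.
move=> FG F0 G0; set H := (fun m n k => _).
have HE : iter N dif23 H = iter N dif23 G.
  by apply: fun3P => m n k; rewrite iter_dif23D F0 add0r.
rewrite iterD; apply: dif23_vanish.
  by rewrite (iter_comm dif12_23) FG iter_fix // dif23_0.
by rewrite HE (iter_comm dif13_23) G0 iter_fix // dif23_0.
Qed.

End Dong.

(** The square-zero extension [K + V] is a commutative ring, so that [ring]
    decides linear identities in [V]. *)
Section SquareZeroExtension.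
Variables (K : comNzRingType) (V : lmodType K).

Definition sqzero : Type := (K * V)%type.
HB.instance Definition _ := GRing.Zmodule.on sqzero.

Let one : sqzero := (1, 0).
Let mul (x y : sqzero) : sqzero := (x.1 * y.1, x.1 *: y.2 + y.1 *: x.2).

Let mulA : associative mul.
Proof.
move=> [a x] [b y] [c z]; rewrite /mul /= mulrA !scalerDr !scalerA addrA.
by rewrite [c * a]mulrC [c * b]mulrC.
Qed.

Let mulC : commutative mul.
Proof. by move=> [a x] [b y]; rewrite /mul /= mulrC addrC. Qed.

Let mul1 : left_id one mul.
Proof. by move=> [a x]; rewrite /mul /= mul1r scale1r scaler0 addr0. Qed.

Let mulD : left_distributive mul +%R.
Proof.
move=> [a x] [b y] [c z]; rewrite /mul /= mulrDl scalerDl scalerDr.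
by rewrite addrACA.
Qed.

Let one_neq0 : one != 0.
Proof. by apply/eqP => -[/eqP]; rewrite oner_eq0. Qed.

HB.instance Definition _ :=
  GRing.Zmodule_isComNzRing.Build sqzero mulA mulC mul1 mulD one_neq0.

Definition sqzero_scalar (c : K) : sqzero := (c, 0).
Definition sqzero_vector (v : V) : sqzero := (0, v).

Let scalar_zmod : zmod_morphism sqzero_scalar.
Proof. by move=> a b; rewrite /sqzero_scalar; congr pair; rewrite /= subr0. Qed.

Let scalar_monoid : monoid_morphism sqzero_scalar.
Proof.
by split=> // a b; congr pair; rewrite /= !scaler0 addr0.
Qed.

Let vector_zmod : zmod_morphism sqzero_vector.
Proof. by move=> a b; congr pair; rewrite /= subr0. Qed.

HB.instance Definition _ :=
  GRing.isZmodMorphism.Build K sqzero sqzero_scalar scalar_zmod.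
HB.instance Definition _ :=
  GRing.isMonoidMorphism.Build K sqzero sqzero_scalar scalar_monoid.
HB.instance Definition _ :=
  GRing.isZmodMorphism.Build V sqzero sqzero_vector vector_zmod.

Lemma sqzero_vectorZ c v :
  sqzero_vector (c *: v) = sqzero_scalar c * sqzero_vector v.
Proof. by congr pair; rewrite /= ?mulr0 // scale0r addr0. Qed.

Lemma sqzero_vector_inj : injective sqzero_vector.
Proof. by move=> u v []. Qed.

Lemma sqzero_vectorD u v :
  sqzero_vector (u + v) = sqzero_vector u + sqzero_vector v.
Proof. exact: raddfD. Qed.

Lemma sqzero_vectorN v : sqzero_vector (- v) = - sqzero_vector v.
Proof. exact: raddfN. Qed.

Lemma sqzero_vector0 : sqzero_vector 0 = 0.
Proof. by []. Qed.
End SquareZeroExtension.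

Ltac lmod_ring :=
  apply: sqzero_vector_inj;
  rewrite ?(sqzero_vectorD, sqzero_vectorN, sqzero_vector0, sqzero_vectorZ);
  ring.

(** * The commutator formula *)

Section DifferenceSlices.
Variable V : zmodType.
Implicit Types f g : int -> int -> V.

Lemma iter_dif_eq0 N M f : (N <= M)%N ->
  (forall m n, iter N dif f m n = 0) -> forall m n, iter M dif f m n = 0.
Proof.
move=> le_NM f0; rewrite -(subnK le_NM) iterD.
elim: (M - N)%N => //= i IH m n.
by rewrite /dif !IH subr0.
Qed.

Lemma iter_dif_map (phi : V -> V) (phiB : {morph phi : x y / x - y}) f j m n :
  iter j dif (fun m n => phi (f m n)) m n = phi (iter j dif f m n).
Proof. by elim: j m n => //= j IH m n; rewrite {1 2}/dif !IH phiB. Qed.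

Lemma iter_difB f g j m n :
  iter j dif (fun m n => f m n - g m n) m n =
  iter j dif f m n - iter j dif g m n.
Proof.
elim: j m n => //= j IH m n; rewrite {1 2 3}/dif !IH.
exact: subrACA.
Qed.

Lemma iter_dif12E F j m n k :
  iter j (@dif12 V) F m n k = iter j dif (fun m n => F m n k) m n.
Proof. by elim: j m n => //= j IH m n; rewrite /dif12 /dif !IH. Qed.

Lemma iter_dif13E F j m n k :
  iter j (@dif13 V) F m n k = iter j dif (fun m k => F m n k) m k.
Proof. by elim: j m k => //= j IH m k; rewrite /dif13 /dif !IH. Qed.

Lemma iter_dif23E F j m n k :
  iter j (@dif23 V) F m n k = iter j dif (fun n k => F m n k) n k.
Proof. by elim: j n k => //= j IH n k; rewrite /dif23 /dif !IH. Qed.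

End DifferenceSlices.

Lemma sgn_xor (R : comNzRingType) (p q r : bool) :
  (-1) ^+ ((p (+) q) && r) = (-1) ^+ (p && r) * (-1) ^+ (q && r) :> R.
Proof.
by case: p q r => [] [] [];
  rewrite /= ?expr0 ?expr1 ?mulr1 ?mul1r ?mulrNN ?mulr1.
Qed.

Section CommutatorFormula.
Variables (R : realType) (V : lmodType R[i]) (VA : vertexAlgebra V).
Local Notation C := (R[i]).
Local Notation Y := (vprod VA).
Local Notation vac := (vacuum VA).
Local Notation T := (transl VA).

HB.instance Definition _ a n :=
  GRing.isLinear.Build C V V _ (vprod VA a n) (vprod_linearr VA a n).

Definition vprodl n b : V -> V := fun a => Y a n b.
HB.instance Definition _ n b :=
  GRing.isLinear.Build C V V _ (vprodl n b) (vprod_linearl VA n b).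

Lemma vprodDl a a' n b : Y (a + a') n b = Y a n b + Y a' n b.
Proof. exact: (linearD (vprodl n b)). Qed.

Lemma vprodZl c a n b : Y (c *: a) n b = c *: Y a n b.
Proof. exact: (linearZ_LR (vprodl n b)). Qed.

Lemma vprod0l n b : Y 0 n b = 0.
Proof. exact: (linear0 (vprodl n b)). Qed.

Lemma vprodNl a n b : Y (- a) n b = - Y a n b.
Proof. exact: (linearN (vprodl n b)). Qed.

Lemma parity_decomposition v : exists v0 v1,
  [/\ vparity VA false v0, vparity VA true v1 & v = v0 + v1].
Proof.
have [f [[Pf _ ->] _]] := vparity_direct VA v.
exists (f false), (f true); split=> //.
rewrite (fsbigE [:: false; true]) //; last by case.
by rewrite !big_cons big_nil !ifT ?inE //= addr0.
Qed.

Lemma parity0 p : vparity VA p 0.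
Proof. by have [] := vparity_subspace VA p. Qed.

Lemma parityD p u v : vparity VA p u -> vparity VA p v -> vparity VA p (u + v).
Proof.
move=> pu pv; have [_ h] := vparity_subspace VA p.
by rewrite -(scale1r u); exact: h.
Qed.

Lemma parityZ p c u : vparity VA p u -> vparity VA p (c *: u).
Proof.
have [h0 h] := vparity_subspace VA p => pu.
by rewrite -[_ *: _]addr0; apply: h.
Qed.

(** * Supercommutators of two fields and their residues *)

Section Pair.
Variables (p q : bool) (a b : V).
Hypotheses (pa : vparity VA p a) (qb : vparity VA q b).
Local Notation s := ((-1) ^+ (p && q) : C).

(** With t the parity sign this is the supercommutator [x_(m), y_(n)] v. The sign is a parameter
    because the super Jacobi identity involves three of them. *)
Definition scomm (t : C) (x y v : V) (m n : int) : V :=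
  Y x m (Y y n v) - t *: Y y n (Y x m v).

Lemma locality_iter : exists N, forall M, (N <= M)%N -> forall v m n,
  iter M dif (scomm s a b v) m n = 0.
Proof.
have [N loc] := vprod_locality pa qb; exists N => M le_NM v.
apply: (iter_dif_eq0 le_NM) => m n.
by rewrite iter_difE; exact: loc.
Qed.

Lemma iter_scomm_linear t j c u v m n :
  iter j dif (scomm t a b (c *: u + v)) m n =
  c *: iter j dif (scomm t a b u) m n + iter j dif (scomm t a b v) m n.
Proof.
elim: j m n => [|j IH] m n /=.
  rewrite /scomm !linearP /= scalerBr scalerN.
  by rewrite addrACA.
by rewrite {1 2 3}/dif !IH scalerBr opprD addrACA.
Qed.

Lemma iter_scomm_vac_ge0 t j (m n : int) : 0 <= m -> 0 <= n ->
  iter j dif (scomm t a b vac) m n = 0.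
Proof.
elim: j m n => [|j IH] m n m0 n0 /=.
  by rewrite /scomm !vacuum_right // !linear0 addr0.
by rewrite {1}/dif !IH ?subrr //; lia.
Qed.

Lemma iter_scomm_vac_m1 t j (m : int) : 0 <= m ->
  iter j dif (scomm t a b vac) m (-1) = Y a (m + j%:Z) b.
Proof.
elim: j m => [|j IH] m m0 /=.
  by rewrite /scomm vacuum_create vacuum_right // linear0 ?scaler0 subr0 addr0.
rewrite {1}/dif IH; last by lia.
rewrite iter_scomm_vac_ge0 // subr0; congr (Y a _ b); lia.
Qed.

Lemma transl_vprod_vac c n : T (Y c n vac) = - n%:~R *: Y c (n - 1) vac.
Proof. by rewrite -transl_covariance transl_vacuum linear0 subr0. Qed.

Lemma transl_vprod c n v : T (Y c n v) = Y c n (T v) - n%:~R *: Y c (n - 1) v.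
Proof. by rewrite -scaleNr -transl_covariance addrC subrK. Qed.

(** On the vacuum T acts as d/dz + d/dw, which annihilates z - w and so commutes with every
    multiplication by it. *)
Lemma transl_iter_scomm_vac t j m n :
  T (iter j dif (scomm t a b vac) m n) =
  - m%:~R *: iter j dif (scomm t a b vac) (m - 1) n
  - n%:~R *: iter j dif (scomm t a b vac) m (n - 1).
Proof.
elim: j m n => [|j IH] m n /=.
  rewrite /scomm linearB linearZ /= !transl_vprod !transl_vacuum.
  by rewrite !linearB /= !linearZ /= !linear0; lmod_ring.
rewrite {1}/dif linearB !IH; set f := iter j dif _.
by rewrite /dif !addrK ?subrK !intrD; lmod_ring.
Qed.

Section Goddard.
Variables (D : int -> V -> V) (e : V).

(** Set w = 0 in (z - w)^M D(z) e(w) 1 = 0: since e_(k) 1 is 0 for k >= 0 and e for k = -1, what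
    remains is z^M D(z) e = 0. *)
Lemma goddard_uniqueness :
  (forall n, D n 0 = 0) ->
  (exists M, forall n k, iter M dif (fun n k => D n (Y e k vac)) n k = 0) ->
  forall n, D n e = 0.
Proof.
move=> D0 [M loc] n; have := loc (n - M%:Z) (-1).
rewrite iter_difE big_ord_recl /= bin0 expr0 mulr1 scale1r subn0 addr0.
rewrite subrK vacuum_create big1 ?addr0 // => i _.
by rewrite vacuum_right ?D0 ?scaler0 //; rewrite /bump; lia.
Qed.

End Goddard.


(** The left side is a coefficient of the residue in z of (z - w)^j [a(z), b(w)] 1. Both sides
    vanish for n >= 0 and equal a_(j)b at n = -1. Below, T gives them the same recursion: on the row
    m = 0 the d/dz term drops out, and the factor n is invertible. *)
Lemma iter_scomm_vac j n : iter j dif (scomm s a b vac) 0 n = Y (Y a j b) n vac.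
Proof.
have [n0|n0] := leP 0 n.
  by rewrite iter_scomm_vac_ge0 // vacuum_right.
case: n n0 => // n _; rewrite NegzE; elim: n => [|n IH].
  by rewrite iter_scomm_vac_m1 // vacuum_create add0r.
have := transl_iter_scomm_vac s j 0 (- n.+1%:Z); rewrite IH transl_vprod_vac.
rewrite mulr0z oppr0 scale0r sub0r scaleNr => /oppr_inj /scalerI.
rewrite (_ : - n.+1%:Z - 1 = - n.+2%:Z); last by lia.
by move=> -> //; rewrite intr_eq0.
Qed.

End Pair.
(** The residue of (z1 - z2)^j [a(z1), b(z2)] is local with e(z3). By the super Jacobi identity
    [[a, b], e] is [G2], built on [b, e] and killed by a power of z2 - z3, plus [G3], built on
    [a, e] and killed by a power of z1 - z3. *)
Lemma dong_scomm p q r a b e v :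
  vparity VA p a -> vparity VA q b -> vparity VA r e ->
  exists N, forall j n k,
    iter N dif (fun n k =>
      iter j dif (scomm ((-1) ^+ (p && q)) a b (Y e k v)) 0 n
      - (-1) ^+ ((p (+) q) && r) *:
        Y e k (iter j dif (scomm ((-1) ^+ (p && q)) a b v) 0 n)) n k = 0.
Proof.
move=> pa qb re.
have [N1 ab0] := locality_iter pa qb.
have [N2 ae0] := locality_iter pa re.
have [N3 be0] := locality_iter qb re.
set s := (-1) ^+ (p && q) in ab0 *; set t := (-1) ^+ (p && r) in ae0.
set u := (-1) ^+ (q && r) in be0.
pose N := (N1 + N2 + N3)%N; rewrite sgn_xor -/t -/u.
pose G2 m n k := Y a m (scomm u b e v n k)
  - (s * t) *: scomm u b e (Y a m v) n k.
pose G3 m n k := u *: scomm t a e (Y b n v) m k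
  - s *: Y b n (scomm t a e v m k).
pose F m n k := G2 m n k + G3 m n k.
have [le1 le2 le3] : [/\ (N1 <= N)%N, (N2 <= N)%N & (N3 <= N)%N].
  by rewrite /N; split; lia.
have FE m n k : F m n k = scomm s a b (Y e k v) m n
    - (t * u) *: Y e k (scomm s a b v m n).
  rewrite /F /G2 /G3 /scomm !linearB /= !linearZ /=.
  lmod_ring.
have BZ c x k : {morph (fun z => c *: Y x k z) : x y / x - y}.
  by move=> f g; rewrite linearB /= scalerBr.
have iterF j m n k : iter j (@dif12 V) F m n k
    = iter j dif (scomm s a b (Y e k v)) m n
      - (t * u) *: Y e k (iter j dif (scomm s a b v) m n).
  rewrite iter_dif12E -(iter_dif_map (BZ _ _ _)).
  by rewrite -iter_difB; congr (iter _ _ _ _ _);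
    apply/funext => m'; apply/funext => n'; exact: FE.
have F0 : iter N (@dif12 V) F = @fun3_0 V.
  apply: fun3P => m n k; by rewrite iterF !ab0 // linear0 scaler0 subr0.
have G20 : iter N (@dif23 V) G2 = @fun3_0 V.
  apply: fun3P => m n k; rewrite iter_dif23E iter_difB.
  rewrite (iter_dif_map (linearB _)) be0 //.
  rewrite (iter_dif_map (scalerBr _)) be0 //.
  by rewrite linear0 scaler0 subrr.
have G30 : iter N (@dif13 V) G3 = @fun3_0 V.
  apply: fun3P => m n k; rewrite iter_dif13E iter_difB.
  rewrite (iter_dif_map (scalerBr _)) ae0 //.
  rewrite (iter_dif_map (BZ _ _ _)) ae0 //.
  by rewrite !linear0 addr0.
have dF := dong F0 G20 G30.
exists (N + N + N)%N => j n k.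
have : iter (N + N + N) (@dif23 V) (iter j (@dif12 V) F) 0 n k = 0.
  rewrite -(iter_comm (@dif12_23 V)) dF iter_fix //; exact: dif12_0.
rewrite iter_dif23E => <-; congr (iter _ _ _ _ _).
by apply/funext => n'; apply/funext => k'; rewrite iterF.
Qed.

(** The difference D of the two sides kills the vacuum, so D e_(k) 1 is a supercommutator of D with
    e_(k). Both sides being local with e, Goddard's argument gives D e = 0. *)
Lemma iter_scomm_prod p q a b j n v :
  vparity VA p a -> vparity VA q b ->
  iter j dif (scomm ((-1) ^+ (p && q)) a b v) 0 n = Y (Y a j b) n v.
Proof.
move=> pa qb; apply/eqP; rewrite -subr_eq0; apply/eqP.
set s := (-1) ^+ (p && q).
pose D n v := iter j dif (scomm s a b v) 0 n - Y (Y a j b) n v.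
have DP c x y k : D k (c *: x + y) = c *: D k x + D k y.
  by rewrite /D iter_scomm_linear linearP /=; lmod_ring.
have D0 k : D k 0 = 0.
  by have := DP (-1) 0 0 k; rewrite scaler0 add0r scaleN1r addNr.
suff Dhom r e : vparity VA r e -> D n e = 0.
  have [v0 [v1 [/Dhom v00 /Dhom v10 ->]]] := parity_decomposition v.
  by rewrite -[LHS]/(D n (v0 + v1)) -[v0]scale1r DP v00 v10 scaler0 addr0.
move=> re; apply: goddard_uniqueness => //.
have [N1 loc1] := dong_scomm vac pa qb re.
have [N2 loc2] := locality_iter (vprod_parity j pa qb) re.
exists (N1 + N2)%N => m k.
have : iter (N1 + N2) dif (fun n k =>
      (iter j dif (scomm s a b (Y e k vac)) 0 n
      - (-1) ^+ ((p (+) q) && r) *: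
        Y e k (iter j dif (scomm s a b vac) 0 n))
    - scomm ((-1) ^+ ((p (+) q) && r)) (Y a j b) e vac n k) m k = 0.
  rewrite iter_difB loc2 ?leq_addl // subr0.
  by apply: (iter_dif_eq0 (leq_addr _ _)); exact: loc1.
move=> <-; congr (iter _ _ _ _ _).
apply/funext => n'; apply/funext => k'.
rewrite /D /scomm iter_scomm_vac; lmod_ring.
Qed.

(** The bound is uniform in m, n and v, and every larger N is allowed, so that several expansions
    can be given the same length. *)
Theorem commutator_formula p q a b : vparity VA p a -> vparity VA q b ->
  exists N0, forall N, (N0 <= N)%N -> forall (m n : int) v,
    Y a m (Y b n v) - (-1) ^+ (p && q) *: Y b n (Y a m v)
    = \sum_(j < N) gbin C m j *: Y (Y a j b) (m + n - j%:Z) v.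
Proof.
move=> pa qb; have [N0 loc] := locality_iter pa qb.
exists N0 => N le_N0 m n v.
rewrite -[LHS]/(scomm _ a b v m n) (newton_expansion (loc N le_N0 v)).
by apply: eq_bigr => j _; rewrite (iter_scomm_prod _ _ _ pa qb).
Qed.

End CommutatorFormula.

(** * Finitely supported sums and direct sums *)

Section FinitelySupportedSums.
Variables (I : choiceType) (V : zmodType).
Implicit Types f g : I -> V.

Lemma fsum_seq (r : seq I) f : uniq r -> (forall i, i \notin r -> f i = 0) ->
  \sum_(i \in [set: I]) f i = \sum_(i <- r) f i.
Proof.
move=> r_uniq f0; rewrite (fsbigE r) //; last by move=> i _; exact: f0.
by apply: eq_bigl => i; rewrite in_setT.
Qed.

Lemma finite_support_seq f : finite_set [set i | f i != 0] ->
  exists2 r : seq I, uniq r & forall i, i \notin r -> f i = 0.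
Proof.
move=> /finite_seqP [s fs]; exists (undup s); first exact: undup_uniq.
move=> i; rewrite mem_undup => i_s; apply/eqP; apply: contraNT i_s => fi.
by have : [set i | f i != 0] i by []; rewrite fs.
Qed.

Lemma finite_support_sub f g : (forall i, f i = 0 -> g i = 0) ->
  finite_set [set i | f i != 0] -> finite_set [set i | g i != 0].
Proof.
move=> fg; apply: sub_finite_set => i /= gi; apply: contra_neq gi.
exact: fg.
Qed.

Lemma finite_support_morph (W : zmodType) (phi : V -> W) f : phi 0 = 0 ->
  finite_set [set i | f i != 0] -> finite_set [set i | phi (f i) != 0].
Proof.
move=> phi0; apply: sub_finite_set => i /=; apply: contra_neq.
by move=> ->.
Qed.

Lemma finite_support2 f g : finite_set [set i | f i != 0] ->
  finite_set [set i | g i != 0] ->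
  exists r : seq I, [/\ uniq r, forall i, i \notin r -> f i = 0
    & forall i, i \notin r -> g i = 0].
Proof.
move=> /finite_support_seq [r _ f0] /finite_support_seq [s _ g0].
exists (undup (r ++ s)); split; first exact: undup_uniq.
  by move=> i; rewrite mem_undup mem_cat negb_or => /andP [/f0].
by move=> i; rewrite mem_undup mem_cat negb_or => /andP [_ /g0].
Qed.

Lemma fsumD f g : finite_set [set i | f i != 0] ->
  finite_set [set i | g i != 0] ->
  \sum_(i \in [set: I]) (f i + g i)
  = \sum_(i \in [set: I]) f i + \sum_(i \in [set: I]) g i.
Proof.
move=> ff fg; have [r [ru f0 g0]] := finite_support2 ff fg.
rewrite !(fsum_seq ru) ?big_split // => i ir.
by rewrite f0 ?g0 ?addr0.
Qed.

Lemma fsum_morph (W : zmodType) (phi : V -> W) f :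
  phi 0 = 0 -> {morph phi : x y / x + y} -> finite_set [set i | f i != 0] ->
  phi (\sum_(i \in [set: I]) f i) = \sum_(i \in [set: I]) phi (f i).
Proof.
move=> phi0 phiD /finite_support_seq [r ru f0].
rewrite (fsum_seq ru f0) (big_morph _ phiD phi0).
rewrite (@fsbigE _ _ _ _ [set: I] r) //; last by move=> i _ /f0 ->.
by apply: eq_bigl => i; rewrite in_setT.
Qed.

(** Taking for phi the multiplication by c or by the conjugate of c, this yields both linearity and
    conjugate linearity of finitely supported sums. *)
Lemma fsum_semilinear (phi : V -> V) f g h :
  phi 0 = 0 -> {morph phi : x y / x + y} ->
  finite_set [set i | f i != 0] -> finite_set [set i | g i != 0] ->
  (forall i, h i = phi (f i) + g i) ->
  \sum_(i \in [set: I]) h i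
  = phi (\sum_(i \in [set: I]) f i) + \sum_(i \in [set: I]) g i.
Proof.
move=> phi0 phiD ff fg hE; rewrite (eq_fsbigr (fun i => phi (f i) + g i)) //.
by rewrite fsumD ?(fsum_morph phi0) //; exact: finite_support_morph.
Qed.

Lemma fsum1 i0 f : (forall i, i != i0 -> f i = 0) ->
  \sum_(i \in [set: I]) f i = f i0.
Proof.
move=> f0; rewrite (@fsum_seq [:: i0]) ?big_seq1 // => i.
by rewrite inE; exact: f0.
Qed.

End FinitelySupportedSums.

Section DirectSum.
Variables (I : choiceType) (K : nzRingType) (V : lmodType K) (U : I -> set V).
Hypothesis U_subspace : forall i, Defs.subspace (U i).

Lemma decomposesP c u v f g : decomposes U u f -> decomposes U v g ->
  decomposes U (c *: u + v) (fun i => c *: f i + g i).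
Proof.
move=> [Uf ff ->] [Ug fg ->]; split.
- by move=> i; have [_ Ui] := U_subspace i; apply: Ui; [exact: Uf|exact: Ug].
- have [r [ru f0 g0]] := finite_support2 ff fg.
  apply: (@sub_finite_set _ _ [set` r]); last exact: finite_seq.
  move=> i /=; apply: contraTT => ir.
  by rewrite f0 // g0 // scaler0 addr0 negbK.
- have fcf := finite_support_morph (scaler0 _ c) ff.
  by rewrite fsumD // (fsum_morph (scaler0 _ c)) //; exact: scalerDr.
Qed.

Lemma decomposes1 i u : U i u ->
  decomposes U u (fun j => if j == i then u else 0).
Proof.
move=> Uu; split.
- by move=> j; case: eqP => [->|_] //; have [] := U_subspace j.
- apply: (@sub_finite_set _ _ [set i]); last exact: finite_set1.
  by move=> j; apply: contra_neqP => /eqP/negPf ->.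
- by rewrite (fsum1 (i0 := i)) ?eqxx // => j /negPf ->.
Qed.

Hypothesis U_direct : direct_sum U.

Lemma component_eq v f i : decomposes U v f -> component U i v = f i.
Proof.
move=> dvf; apply: xget_unique; first by exists f.
move=> w [g dvg ->]; have [h [_ hu]] := U_direct v.
by rewrite -(hu _ dvf) -(hu _ dvg).
Qed.

Lemma component_decomposes v : decomposes U v (fun i => component U i v).
Proof.
have [f [dvf _]] := U_direct v.
by rewrite (_ : (fun i => _) = f) //; apply/funext => i; exact: component_eq.
Qed.

Lemma componentP i : linear (component U i).
Proof.
move=> c u v.
exact: component_eq (decomposesP c (component_decomposes u) (component_decomposes v)).
Qed.

Lemma component_in i v : U i (component U i v).
Proof. by have [] := component_decomposes v. Qed.

Lemma component_id i v : U i v -> component U i v = v.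
Proof. by move=> /decomposes1 /component_eq ->; rewrite eqxx. Qed.

Lemma component_neq i j v : U i v -> j != i -> component U j v = 0.
Proof. by move=> /decomposes1 /component_eq -> /negPf ->. Qed.

Lemma component_finite v : finite_set [set i | component U i v != 0].
Proof. by have [] := component_decomposes v. Qed.

Lemma component_sum v : v = \sum_(i \in [set: I]) component U i v.
Proof. by have [] := component_decomposes v. Qed.

Lemma direct_sum_ind (Q : V -> Prop) :
  Q 0 -> (forall u v, Q u -> Q v -> Q (u + v)) ->
  (forall i v, U i v -> Q v) -> forall v, Q v.
Proof.
move=> Q0 QD QU v; have [r ru f0] := finite_support_seq (component_finite v).
rewrite (component_sum v) (fsum_seq ru f0).
by elim/big_ind: _ => // i _; apply: QU (component_in i v).
Qed.

End DirectSum.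

(** * Commutators with the Virasoro modes *)

Lemma gbin_small (K : numFieldType) (n k : nat) : (n < k)%N ->
  gbin K n%:Z k = 0.
Proof.
move=> lt_nk; rewrite /gbin (bigD1 (Ordinal lt_nk)) //=.
by rewrite subrr mulr0z !mul0r.
Qed.

Lemma gbin2_2 (K : numFieldType) : gbin K 2 2 = 1.
Proof.
rewrite /gbin !big_ord_recl big_ord0 /= /bump /= mulr1 subr0.
by rewrite (_ : 2 - 1 = 1 :> int) // mulr1 divff // intr_eq0.
Qed.

Section Conformal.
Variables (R : realType) (V : lmodType R[i]) (VA : vertexAlgebra V).
Variable cs : conformalStructure VA.
Local Notation C := (R[i]).
Local Notation Y := (vprod VA).
Local Notation vac := (vacuum VA).
Local Notation T := (transl VA).
Local Notation L := (confL cs).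

Lemma vprod_ind (Q : V -> Prop) : (forall u v, Q u -> Q v -> Q (u + v)) ->
  (forall p v, vparity VA p v -> Q v) -> forall v, Q v.
Proof.
move=> QD Qp v; have [v0 [v1 [p0 p1 ->]]] := parity_decomposition VA v.
by apply: QD; [exact: Qp p0|exact: Qp p1].
Qed.

(** For k >= 0 the binomials cut the sum after k + 1 terms whatever the order of locality, and L
    being even there is no sign. In this indexing L_(0), L_(1), L_(2) are L_{-1} = T, L_0 and
    L_1. *)
Lemma confL_comm (k : nat) a n v :
  Y L k (Y a n v) - Y a n (Y L k v)
  = \sum_(j < k.+1) gbin C k j *: Y (Y L j a) (k%:Z + n - j%:Z) v.
Proof.
elim/vprod_ind: a => [a b IHa IHb|p a pa].
  rewrite !vprodDl linearD /= opprD addrACA IHa IHb -big_split /=.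
  by apply: eq_bigr => j _; rewrite linearD /= vprodDl scalerDr.
have [N0 comm] := commutator_formula (confL_even cs) pa.
have := comm (k.+1 + N0)%N (leq_addl _ _) k n v.
rewrite /= expr0 scale1r => ->; rewrite big_split_ord /= [X in _ + X]big1 ?addr0 //.
by move=> j _; rewrite gbin_small ?scale0r //; lia.
Qed.

Lemma confL0 v : Y L 0 v = T v.
Proof. exact: confL_transl. Qed.

Lemma vprod_transl a n v : Y (T a) n v = - n%:~R *: Y a (n - 1) v.
Proof.
have := confL_comm 0 a n v; rewrite big_ord1 gbin0 scale1r !confL0.
rewrite (_ : 0%:Z + n - _ = n); last by rewrite /=; lia.
by move=> <-; exact: transl_covariance.
Qed.

Lemma confL1_comm a n v : Y L 1 (Y a n v) - Y a n (Y L 1 v) =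
  Y (Y L 1 a) n v - (n + 1)%:~R *: Y a n v.
Proof.
rewrite (confL_comm 1) !big_ord_recl big_ord0 /= gbin0 gbin1 addr0.
rewrite /bump /= confL0 vprod_transl !scale1r.
rewrite (_ : 1%:Z + n - 1 = n); last by lia.
by rewrite addr0 scaleNr addrC [1%:Z + n]addrC.
Qed.

(** For quasiprimary a of weight h this reads [L_1, a_(n)] = (2h - n - 2) a_(n+1), the form of
    sl_2-covariance used below. *)
Lemma confL2_comm a n v : Y L 2 (Y a n v) - Y a n (Y L 2 v) =
  Y (Y L 2 a) n v + 2 *: Y (Y L 1 a) (n + 1) v
  - (n + 2)%:~R *: Y a (n + 1) v.
Proof.
rewrite (confL_comm 2) !big_ord_recl big_ord0 /= gbin0 gbin1 gbin2_2 addr0.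
rewrite /bump /= confL0 vprod_transl !scale1r.
rewrite addr0 scaleNr addrC [2%:Z + n]addrC.
rewrite (_ : n + 2%:Z - 1 = n + 1); last by lia.
rewrite [X in X - _]addrC; congr (Y _ _ _ + _ - _); lia.
Qed.

(** The eigenvalue is an arbitrary complex number, so that weights can be shifted freely, also to
    negative values, where the vector turns out to be 0. *)
Definition has_weight (h : C) (v : V) : Prop := Y L 1 v = h *: v.

Lemma has_weightP h c u v :
  has_weight h u -> has_weight h v -> has_weight h (c *: u + v).
Proof.
rewrite /has_weight => hu hv.
by rewrite linearP /= hu hv scalerDr !scalerA mulrC.
Qed.

Lemma has_weight0 h : has_weight h 0.
Proof. by rewrite /has_weight linear0 scaler0. Qed.

Lemma has_weightZ h c u : has_weight h u -> has_weight h (c *: u).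
Proof. by move=> hu; rewrite -[_ *: _]addr0; apply: has_weightP (has_weight0 h). Qed.

Lemma has_weightD h u v :
  has_weight h u -> has_weight h v -> has_weight h (u + v).
Proof. by move=> hu hv; rewrite -[u]scale1r; exact: has_weightP. Qed.

Lemma has_weight_vprod h k a n v : has_weight h a -> has_weight k v ->
  has_weight (h + k - n%:~R - 1) (Y a n v).
Proof.
move=> ha kv; apply/eqP; rewrite -subr_eq0; apply/eqP.
have := confL1_comm a n v; rewrite ha kv linearZ /= vprodZl intrD => E.
have -> : Y L 1 (Y a n v) = k *: Y a n v + (h *: Y a n v - (n%:~R + 1) *: Y a n v).
  by rewrite -E addrCA subrr addr0.
by lmod_ring.
Qed.

(** The condition on m, satisfied by -1, 0 and 1, removes the central term. *)
Lemma virasoro_eq (m n : int) v : m ^+ 3 = m ->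
  Y L (m + 1) (Y L (n + 1) v) - Y L (n + 1) (Y L (m + 1) v)
  = (m - n)%:~R *: Y L (m + n + 1) v.
Proof.
move=> m3; have := virasoro cs m n v.
by rewrite /Lop m3 subrr mulr0z !mul0r scale0r addr0.
Qed.

Lemma has_weight_transl h v : has_weight h v -> has_weight (h + 1) (T v).
Proof.
move=> hv; rewrite -confL0; have := virasoro_eq (m := 0) (-1) v (expr0n _ 3).
rewrite !add0r addNr hv linearZ /= => E; rewrite /has_weight.
by rewrite scalerDl -[1]/(1%:~R) -E addrCA subrr addr0.
Qed.

Lemma has_weight_L1 h v : has_weight h v -> has_weight (h - 1) (Y L 2 v).
Proof.
move=> hv; have := virasoro_eq (m := 0) 1 v (expr0n _ 3).
rewrite !add0r hv linearZ /= => E; rewrite /has_weight.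
rewrite scalerBl -scaleNr -[- 1]/((- 1)%:~R) -E.
by rewrite addrCA subrr addr0.
Qed.

Lemma L1_transl v : Y L 2 (T v) = T (Y L 2 v) + 2 *: Y L 1 v.
Proof.
have := virasoro_eq (m := 1) (-1) v (expr1n _ 3).
rewrite addNr !confL0 subrr add0r => E.
by rewrite -[LHS](subrK (T (Y L 2 v))) [LHS]addrC -[2]/(2%:~R) -E.
Qed.

Lemma L1_iter_transl k h v : has_weight h v ->
  Y L 2 (iter k.+1 T v) = iter k.+1 T (Y L 2 v)
    + (k.+1%:R * (2 * h + k%:R)) *: iter k T v.
Proof.
move=> hv; have hk i : has_weight (h + i%:R) (iter i T v).
  elim: i => [|i IH]; first by rewrite addr0.
  by rewrite -natr1 addrA; exact: has_weight_transl.
elim: k => [|k IH].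
  by rewrite /= L1_transl hv addr0 mul1r scalerA.
rewrite iterS L1_transl IH (hk k.+1) linearD linearZ /= -addrA; congr (_ + _).
rewrite scalerA -scalerDl; congr (_ *: _).
by rewrite -!natr1; ring.
Qed.

Lemma iter_L1_transl k h v : has_weight h v ->
  iter k (Y L 2) (T v) = T (iter k (Y L 2) v)
    + (k%:R * (2 * h - k%:R + 1)) *: iter k.-1 (Y L 2) v.
Proof.
move=> hv; have hk i : has_weight (h - i%:R) (iter i (Y L 2) v).
  elim: i => [|i IH]; first by rewrite subr0.
  by rewrite -natr1 opprD addrA; exact: has_weight_L1.
elim: k => [|k IH]; first by rewrite /= mul0r scale0r addr0.
rewrite iterS IH linearD linearZ /= L1_transl (hk k) -addrA; congr (_ + _).
case: k {IH} => [|k]; first by rewrite /= mul0r scale0r addr0 scalerA; congr (_ *: _); ring.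
rewrite /= scalerA -scalerDl; congr (_ *: _).
by rewrite -!natr1; ring.
Qed.

Lemma has_weight_vac : has_weight 0 vac.
Proof. by rewrite /has_weight vacuum_right // scale0r. Qed.

Lemma L1_vac : Y L 2 vac = 0.
Proof. exact: vacuum_right. Qed.

End Conformal.

(** * Quasiprimary vectors and the expectation value *)

Section Decomposition.
Variables (R : realType) (V : lmodType R[i]) (VA : vertexAlgebra V).
Variable cs : conformalStructure VA.
Local Notation C := (R[i]).
Local Notation Y := (vprod VA).
Local Notation vac := (vacuum VA).
Local Notation T := (transl VA).
Local Notation L := (confL cs).
Local Notation half d := (d%:R / 2 : C).
Local Notation wpart := (weight_part cs).

Lemma weightE q v : weight cs q v = has_weight cs (ratr q) v.
Proof. by []. Qed.

Lemma ratr_halfq d : ratr (halfq d) = half d.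
Proof. by rewrite /halfq fmorph_div !rmorph_nat. Qed.

Lemma halfSS d : half d.+2 = half d + 1.
Proof. by rewrite -(addn2 d) natrD mulrDl divff // pnatr_eq0. Qed.

Lemma weight_half d v : weight cs (halfq d) v = has_weight cs (half d) v.
Proof. by rewrite weightE ratr_halfq. Qed.

Lemma weight_subspace (d : nat) : Defs.subspace (weight cs (halfq d)).
Proof.
by split=> [|c u v]; rewrite !weight_half; [exact: has_weight0|exact: has_weightP].
Qed.

Lemma weight_partP d : linear (wpart d).
Proof. exact: componentP weight_subspace (weight_direct cs) d. Qed.
HB.instance Definition _ d :=
  GRing.isLinear.Build C V V _ (weight_part cs d) (weight_partP d).

Lemma weight_part_in d v : has_weight cs (half d) (wpart d v).
Proof. by rewrite -weight_half; exact: component_in (weight_direct cs) d v. Qed.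

Lemma weight_part_id d v : has_weight cs (half d) v -> wpart d v = v.
Proof.
by rewrite -weight_half; exact: (component_id weight_subspace (weight_direct cs)).
Qed.

Lemma weight_part_neq d e v : has_weight cs (half d) v -> e != d -> wpart e v = 0.
Proof.
by rewrite -weight_half; exact: (component_neq weight_subspace (weight_direct cs)).
Qed.

Lemma weight_part_finite v : finite_set [set d | wpart d v != 0].
Proof. exact: component_finite (weight_direct cs) v. Qed.

(** The component of L_0 v = h v in degree d is both h and d/2 times that of v, so a nonzero
    component forces h = d/2. *)
Lemma has_weight_half h v : has_weight cs h v -> v = 0 \/ exists d, h = half d.
Proof.
move=> hv; have [[d dv]|nv] := pselect (exists d, wpart d v != 0); last first.
  left; rewrite (component_sum (weight_direct cs) v) fsbig1 // => d _.
  by apply/eqP; apply: contra_notT nv => dv; exists d.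
right; exists d; apply/eqP; apply: contraNT dv => hd; apply/eqP.
have [W Wf Ws] := component_decomposes (weight_direct cs) v.
have : decomposes (fun d : nat => weight cs (halfq d)) (h *: v)
    (fun d => half d *: wpart d v).
  rewrite -hv; split.
  - by move=> e; rewrite weight_half; apply: has_weightZ; exact: weight_part_in.
  - by apply: finite_support_sub Wf => e We; rewrite /weight_part We scaler0.
  rewrite {1}Ws (fsum_morph (linear0 (vprod VA L 1)) (linearD (vprod VA L 1)) Wf).
  by apply: eq_fsbigr => e _; exact: weight_part_in.
move=> /(component_eq (weight_direct cs) d) /esym.
rewrite -/(wpart d (h *: v)) linearZ /= => /eqP.
rewrite -subr_eq0 -scalerBl scaler_eq0 subr_eq0 eq_sym (negPf hd) /=.
by move/eqP.
Qed.

Lemma has_weight_lt0 h v : has_weight cs h v -> h < 0 -> v = 0.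
Proof.
move=> /has_weight_half [//|[d ->]] /lt_geF.
by rewrite divr_ge0.
Qed.

(** Here and in what follows d is twice the weight. *)
Definition homog (d : nat) (p : bool) (v : V) : Prop :=
  has_weight cs (half d) v /\ vparity VA p v.

Lemma parity_disjoint v : vparity VA false v -> vparity VA true v -> v = 0.
Proof.
move=> v0 v1.
rewrite -(component_id (vparity_subspace VA) (vparity_direct VA) v0).
exact: (component_neq (vparity_subspace VA) (vparity_direct VA) v1).
Qed.

Lemma parityP p c u v : vparity VA p u -> vparity VA p v ->
  vparity VA p (c *: u + v).
Proof. by move=> pu pv; apply: parityD => //; exact: parityZ. Qed.

Lemma parity_L p n v : vparity VA p v -> vparity VA p (Y L n v).
Proof. exact: vprod_parity (confL_even cs). Qed.

Lemma homogP d p c u v : homog d p u -> homog d p v -> homog d p (c *: u + v).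
Proof.
by move=> [? ?] [? ?]; split; [exact: has_weightP|exact: parityP].
Qed.

Lemma homog0 d p : homog d p 0.
Proof. by split; [exact: has_weight0|exact: parity0]. Qed.

Lemma homogZ d p c u : homog d p u -> homog d p (c *: u).
Proof. by move=> hu; rewrite -[_ *: _]addr0; apply: homogP (homog0 d p). Qed.

Lemma homog_transl d p v : homog d p v -> homog d.+2 p (T v).
Proof.
move=> [hv pv]; split; last by rewrite -(confL0 cs); exact: parity_L.
by rewrite halfSS; exact: has_weight_transl.
Qed.

Lemma homog_L1 d p v : homog d.+2 p v -> homog d p (Y L 2 v).
Proof.
move=> [hv pv]; split; last exact: parity_L.
by rewrite -[half d](addrK 1) -halfSS; exact: has_weight_L1.
Qed.

Lemma L1_low d v : (d < 2)%N -> has_weight cs (half d) v -> Y L 2 v = 0.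
Proof.
move=> lt_d2 /has_weight_L1 /has_weight_lt0; apply.
by rewrite subr_lt0 ltr_pdivrMr // mul1r ltr_nat.
Qed.

(** L_0 preserves parity, so the failures of the two parity components to be eigenvectors are
    opposite vectors of different parity, hence zero. *)
Lemma homog_split d v : has_weight cs (half d) v -> exists v0 v1,
  [/\ homog d false v0, homog d true v1 & v = v0 + v1].
Proof.
move=> hv; have [v0 [v1 [p0 p1 vE]]] := parity_decomposition VA v.
have pw p u : vparity VA p u -> vparity VA p (Y L 1 u - half d *: u).
  by move=> pu; rewrite addrC -scaleNr; apply: parityP => //; exact: parity_L.
have E : Y L 1 v0 - half d *: v0 = - (Y L 1 v1 - half d *: v1).
  apply/eqP; rewrite -addr_eq0 addrACA -linearD /= -opprD -scalerDr -vE hv.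
  by rewrite subrr.
have D0 : Y L 1 v0 - half d *: v0 = 0.
  apply: parity_disjoint; first exact: pw.
  by rewrite E -scaleN1r; apply: parityZ; exact: pw.
exists v0, v1; split=> //; split=> //.
  by apply/eqP; rewrite -subr_eq0 D0.
by apply/eqP; rewrite -subr_eq0 -oppr_eq0 -E D0.
Qed.

Lemma homog_ind (Q : V -> Prop) : (forall u v, Q u -> Q v -> Q (u + v)) ->
  (forall d p v, homog d p v -> Q v) -> forall v, Q v.
Proof.
move=> QD Qh; apply: (direct_sum_ind (weight_direct cs)) => //.
  exact: Qh (homog0 0 false).
move=> d v; rewrite -[_ v]/(weight cs (halfq d) v) weight_half.
move=> /homog_split [v0 [v1 [h0 h1 ->]]].
by apply: QD; [exact: Qh h0|exact: Qh h1].
Qed.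

Definition qprim (d : nat) (p : bool) (v : V) : Prop :=
  homog d p v /\ Y L 2 v = 0.

(** T adds 2 to the doubled weight, whence d = e + 2k. The inductive form lets a claim be checked on
    T^k q and extended linearly. *)
Inductive sl2span (d : nat) (p : bool) : V -> Prop :=
| sl2span0 : sl2span d p 0
| sl2span_gen e k q : qprim e p q -> d = (e + k.*2)%N ->
    sl2span d p (iter k T q)
| sl2span_lin c u v : sl2span d p u -> sl2span d p v -> sl2span d p (c *: u + v).

Lemma sl2span_homog d p v : sl2span d p v -> homog d p v.
Proof.
elim=> {v} [|e k q [hq _] ->|c u v _ hu _ hv]; first exact: homog0.
  elim: k => [|k IH]; first by rewrite addn0.
  by rewrite doubleS !addnS; exact: homog_transl.
exact: homogP.
Qed.

Lemma sl2span_transl d p v : sl2span d p v -> sl2span d.+2 p (T v).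
Proof.
elim=> {v} [|e k q qq ->|c u v _ hu _ hv]; first by rewrite linear0; exact: sl2span0.
  by apply: (sl2span_gen (k := k.+1) qq); rewrite doubleS !addnS.
by rewrite linearP; exact: sl2span_lin.
Qed.

(** L_1 T multiplies T^k q by (k + 1)(e + k), with e the doubled weight of q. This is zero only for
    e = k = 0, which d > 0 excludes. *)
Lemma sl2span_L1_transl d p w : (0 < d)%N -> sl2span d p w ->
  exists2 u, sl2span d p u & Y L 2 (T u) = w.
Proof.
move=> d0; elim=> {w} [|e k q qq dE|c u v _ [u' hu <-] _ [v' hv <-]].
- by exists 0; [exact: sl2span0|rewrite !linear0].
- pose z := k.+1%:R * (2 * half e + k%:R) : C.
  have z0 : z != 0.
    rewrite mulf_neq0 ?pnatr_eq0 // mulrC divfK ?pnatr_eq0 // -natrD pnatr_eq0.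
    by move: d0; rewrite dE -muln2; case: (e) => //=; case: (k).
  exists (z^-1 *: iter k T q).
    by rewrite -[_ *: _]addr0; apply: sl2span_lin; [exact: sl2span_gen qq dE|exact: sl2span0].
  rewrite !linearZ /= -iterS (L1_iter_transl k qq.1.1) qq.2.
  rewrite (_ : iter _ _ 0 = 0); last by elim: (k.+1) => //= ? ->; rewrite linear0.
  by rewrite add0r scalerA mulVf // scale1r.
- exists (c *: u' + v'); first exact: sl2span_lin.
  by rewrite !linearP.
Qed.

Hypothesis hV1 : forall v, weight cs 1 v -> quasiprimary cs 1 v.

Lemma L1_weight1 v : has_weight cs 1 v -> Y L 2 v = 0.
Proof. by have := @hV1 v; rewrite weightE rmorph1 => /[apply] -[]. Qed.

(** If L_1 T u = L_1 v, then v - T u is quasiprimary. Such a u exists as soon as L_1 v has positive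
    weight; for smaller weights L_1 v is 0 by positivity or, when v has weight 1, by hypothesis. *)
Lemma homog_sl2span d p v : homog d p v -> sl2span d p v.
Proof.
elim/ltn_ind: d v => d IH v hv.
have qs u : homog d p u -> Y L 2 u = 0 -> sl2span d p u.
  by move=> hu Lu; apply: (@sl2span_gen d p d 0 u) => //; rewrite addn0.
case: d => [|[|[|d]]] in IH hv qs *.
- by apply: qs => //; apply: L1_low hv.1.
- by apply: qs => //; apply: L1_low hv.1.
- apply: qs => //; apply: L1_weight1.
  by have := hv.1; rewrite divff // pnatr_eq0.
have [u su uE] := sl2span_L1_transl (ltn0Sn d) (IH _ (leqnSn d.+2) _ (homog_L1 hv)).
rewrite -(subrK (T u) v) -[v - T u]scale1r; apply: sl2span_lin; last exact: sl2span_transl.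
apply: qs; last by rewrite linearB /= uE subrr.
rewrite addrC -scaleN1r; apply: homogP => //.
exact: homog_transl (sl2span_homog su).
Qed.

(** [L_1 V_1 = 0] makes [V] spanned by the [T^k q] with [q] quasiprimary. *)
Lemma quasiprimary_ind (Q : V -> Prop) : Q 0 ->
  (forall c u v, Q u -> Q v -> Q (c *: u + v)) ->
  (forall v, Q v -> Q (T v)) ->
  (forall d p q, qprim d p q -> Q q) -> forall v, Q v.
Proof.
move=> Q0 QP QT Qq; apply: homog_ind => [u v Qu Qv|d p v /homog_sl2span].
  by rewrite -[u]scale1r; exact: QP.
elim=> // [e k q qq _|c u w _ Qu _ Qw]; last exact: QP.
by elim: k => [|k IH]; [exact: Qq qq|exact: QT].
Qed.

(** * The expectation value and the modes it annihilates *)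

Lemma vevE v c : wpart 0 v = c *: vac -> vev cs v = c.
Proof.
move=> vc; apply: xget_unique => // c'; rewrite /= vc => /eqP.
rewrite -subr_eq0 -scalerBl scaler_eq0 (negPf (vacuum_neq0 cs)) orbF subr_eq0.
by move/eqP.
Qed.

Lemma vevP v : wpart 0 v = vev cs v *: vac.
Proof.
have : has_weight cs (ratr 0) (wpart 0 v).
  by have := weight_part_in 0 v; rewrite mul0r rmorph0.
rewrite -weightE => /(weight0_vacuum cs) [c vc].
by rewrite (vevE vc).
Qed.

Lemma vev_linear : scalar (vev cs).
Proof.
move=> c u v; apply: vevE; rewrite linearP /= !vevP.
by rewrite scalerDl scalerA.
Qed.
HB.instance Definition _ := GRing.isLinear.Build C V C _ (vev cs) vev_linear.

Lemma vev_vac : vev cs vac = 1.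
Proof.
apply: vevE; rewrite scale1r weight_part_id // mul0r.
exact: has_weight_vac.
Qed.

Lemma vev_weight h v : has_weight cs h v -> h != 0 -> vev cs v = 0.
Proof.
move=> hv; have [->|[d dE]] := has_weight_half hv; first by rewrite linear0.
rewrite dE => d0; apply: vevE; rewrite scale0r.
apply: (weight_part_neq (d := d)); first by rewrite -dE.
by apply: contraNneq d0 => <-; rewrite mul0r.
Qed.

(** Only a component of v of weight 1 could contribute, and there L_1 v = 0 by hypothesis. *)
Lemma vev_L1 v : vev cs (Y L 2 v) = 0.
Proof.
elim/homog_ind: v => [u v Hu Hv|d p v [hv _]].
  by rewrite !linearD /= Hu Hv addr0.
have [d1|d1] := eqVneq (half d) 1.
  by rewrite L1_weight1 ?linear0 // /has_weight -d1.
by apply: vev_weight (has_weight_L1 hv) _; rewrite subr_eq0.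
Qed.

(** The expectation value of [L_1, q_(n-1)] w gives (d - 1 - n) <q_(n) w> = - <q_(n-1) L_1 w>. The
    factor is nonzero for n <= d - 2, and L_1 lowers the weight of w, so the induction ends at L_1 w
    = 0. *)
Lemma vev_qprim d p q n w : qprim d p q -> n <= d%:Z - 2 -> vev cs (Y q n w) = 0.
Proof.
move=> [[hq _] Lq]; elim/homog_ind: w n => [u v Hu Hv n nd|e p' w [hw _] n nd].
  by rewrite !linearD /= Hu ?Hv ?addr0.
elim/ltn_ind: e w hw n nd => e IH w hw n nd.
have := confL2_comm cs q (n - 1) w.
rewrite Lq vprod0l add0r hq vprodZl subrK.
move=> /(congr1 (vev cs)); rewrite scalerA -scalerBl !linearB /= vev_L1 linearZ /=.
rewrite (_ : vev cs (Y q (n - 1) (Y L 2 w)) = 0); last first.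
  case: e => [|[|e]] in IH hw.
  - by rewrite (L1_low _ hw) ?linear0.
  - by rewrite (L1_low _ hw) ?linear0.
  apply: (IH e); [by rewrite ltnW| |by lia].
  by rewrite -[half e](addrK 1) -halfSS; exact: has_weight_L1.
rewrite subr0 => /esym/eqP; rewrite mulf_eq0 => /orP [|/eqP //].
rewrite mulrC divfK ?pnatr_eq0 // subr_eq0 -[d%:R]/((d%:Z)%:~R) eqr_int.
by move=> /eqP dn; move: nd; rewrite dn; lia.
Qed.

End Decomposition.

(** * The involution and the operators A(z) *)

Section ComplexExponential.
Variable R : realType.

Lemma cexpD (x y : R[i]) : cexp (x + y) = cexp x * cexp y.
Proof.
case: x y => [a b] [c d]; rewrite /cexp /= expRD cosD sinD.
by apply/eqP; rewrite eq_complex /=; apply/andP; split; apply/eqP; ring.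
Qed.

(** With n twice the weight plus the parity, this turns the phases of g into powers of - i. *)
Lemma cexp_half_pi (n : nat) :
  cexp (- ((pi : R)%:C%C * 'i%C * (n%:R / 2))) = (- 'i%C) ^+ n.
Proof.
have E0 : cexp (0 : R[i]) = 1 by rewrite /cexp /= expR0 cos0 sin0 !mul1r.
have E1 : cexp (- ((pi : R)%:C%C * 'i%C * (1 / 2))) = - 'i%C.
  have -> : - ((pi : R)%:C%C * 'i%C * (1 / 2)) = Complex 0 (- (pi / 2)) :> R[i].
    have -> : 1 / 2 = (2^-1 : R)%:C%C :> R[i] by rewrite mul1r fmorphV rmorph_nat.
    by apply/eqP; rewrite eq_complex /=; apply/andP; split; apply/eqP; ring.
  rewrite /cexp /= expR0 cosN sinN cos_pihalf sin_pihalf.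
  by apply/eqP; rewrite eq_complex /=; apply/andP; split; apply/eqP; ring.
elim: n => [|n IH]; first by rewrite mul0r mulr0 oppr0 expr0.
by rewrite -natr1 mulrDl mulrDr opprD cexpD IH E1 exprSr.
Qed.

End ComplexExponential.

Section FiniteSupport.
Variables (I : choiceType) (V : zmodType).

Lemma finite_support_mem (r : seq I) (f : I -> V) :
  (forall i, i \notin r -> f i = 0) -> finite_set [set i | f i != 0].
Proof.
move=> f0; apply: (@sub_finite_set _ _ [set` r]); last exact: finite_seq.
by move=> i /=; apply: contraNT => /f0 ->.
Qed.

Lemma finite_supportD (f g : I -> V) : finite_set [set i | f i != 0] ->
  finite_set [set i | g i != 0] -> finite_set [set i | f i + g i != 0].
Proof.
move=> ff fg; have [r [_ f0 g0]] := finite_support2 ff fg.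
by apply: (finite_support_mem (r := r)) => i ir; rewrite f0 // g0 // addr0.
Qed.

End FiniteSupport.

Lemma sum_triangle (V : zmodType) (f : nat -> nat -> V) N :
  \sum_(j < N) \sum_(k < N - j) f j (j + k)%N
  = \sum_(l < N) \sum_(j < l.+1) f j l.
Proof.
elim: N => [|N IH]; first by rewrite !big_ord0.
rewrite [RHS]big_ord_recr -IH /= [X in _ = _ + X]big_ord_recr /= addrA.
rewrite -big_split /= big_ord_recr /= subSnn big_ord1 addn0; congr (_ + _).
apply: eq_bigr => j _; rewrite subSn; last by rewrite ltnW.
by rewrite big_ord_recr /= subnKC // ltnW.
Qed.

Section Involution.
Variables (R : realType) (V : lmodType R[i]) (VA : vertexAlgebra V).
Variable cs : conformalStructure VA.
Local Notation C := (R[i]).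
Local Notation Y := (vprod VA).
Local Notation vac := (vacuum VA).
Local Notation T := (transl VA).
Local Notation L := (confL cs).
Local Notation half d := (d%:R / 2 : C).
Local Notation wpart := (weight_part cs).
Variable phi : V -> V.
Hypothesis hphi : conj_linear_involution cs phi.
Local Notation g := (gmap cs phi).

Lemma conj_linear0 (f : V -> V) : conj_linear f -> f 0 = 0.
Proof. by move=> fP; have := fP (-1) 0 0; rewrite scaler0 add0r rmorphN1 scaleN1r addNr. Qed.

Lemma conj_linearD (f : V -> V) : conj_linear f -> {morph f : u v / u + v}.
Proof. by move=> fP u v; rewrite -{1}[u]scale1r fP rmorph1 scale1r. Qed.

Lemma conj_linearZ (f : V -> V) c u : conj_linear f -> f (c *: u) = c^* *: f u.
Proof. by move=> fP; rewrite -[c *: u]addr0 fP conj_linear0 ?addr0. Qed.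

Lemma phiP : conj_linear phi. Proof. exact: involution_conj_linear hphi. Qed.

Lemma phi_L n v : phi (Y L n v) = Y L n (phi v).
Proof. by rewrite (involution_vprod hphi) (involution_confL hphi). Qed.

Lemma phi_transl v : phi (T v) = T (phi v).
Proof. by rewrite -!(confL0 cs) phi_L. Qed.

(** phi(1) = phi(1)_(-1) 1 = phi(1_(-1) phi(1)) = phi(phi(1)) = 1. *)
Lemma phi_vac : phi vac = vac.
Proof.
rewrite -[LHS](vacuum_create VA) -[X in Y _ _ X](involutionK hphi).
by rewrite -(involution_vprod hphi) vacuum_left eqxx (involutionK hphi).
Qed.

Lemma conj_half d : (half d)^* = half d.
Proof. by rewrite rmorphM fmorphV !rmorph_nat. Qed.

Lemma phi_homog d p v : homog cs d p v -> homog cs d p (phi v).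
Proof.
move=> [hv pv]; split; last exact: (involution_parity hphi).
rewrite /has_weight -phi_L hv (conj_linearZ _ _ phiP).
by rewrite conj_half.
Qed.

Definition gterm d v : V := \sum_(p : bool)
  cexp (- ((pi : R)%:C%C * 'i%C * (ratr (halfq d) + (p : nat)%:R / 2)))
    *: phi (parity_part VA p (wpart d v)).

Lemma gtermE d v : gterm d v = \sum_(p : bool)
  (- 'i%C) ^+ (d + p) *: phi (parity_part VA p (wpart d v)).
Proof.
apply: eq_bigr => p _; congr (_ *: _).
by rewrite ratr_halfq -mulrDl -natrD cexp_half_pi.
Qed.

Lemma parity_partP p : linear (parity_part VA p).
Proof. exact: componentP (vparity_subspace VA) (vparity_direct VA) p. Qed.
HB.instance Definition _ p :=
  GRing.isLinear.Build C V V _ (parity_part VA p) (parity_partP p).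

Lemma parity_part_id p v : vparity VA p v -> parity_part VA p v = v.
Proof. exact: (component_id (vparity_subspace VA) (vparity_direct VA)). Qed.

Lemma parity_part_neq p q v : vparity VA p v -> q != p -> parity_part VA q v = 0.
Proof. exact: (component_neq (vparity_subspace VA) (vparity_direct VA)). Qed.

Lemma gtermP d : conj_linear (gterm d).
Proof.
move=> c u v; rewrite !gtermE scaler_sumr -big_split /=.
apply: eq_bigr => p _; rewrite !linearP phiP.
by lmod_ring.
Qed.

Lemma gterm_finite v : finite_set [set d | gterm d v != 0].
Proof.
apply: finite_support_sub (weight_part_finite cs v) => d vd.
have := conj_linear0 (gtermP d); rewrite /gterm.
by rewrite linear0 vd.
Qed.

Lemma gmapP : conj_linear g.
Proof.
move=> c u v; rewrite /gmap.
exact: (fsum_semilinear (phi := fun w => c^* *: w) (scaler0 _ _) (scalerDr _)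
  (gterm_finite u) (gterm_finite v) (fun d => gtermP d c u v)).
Qed.

Lemma gmap_homog d p v : homog cs d p v -> g v = (- 'i%C) ^+ (d + p) *: phi v.
Proof.
move=> [hv pv]; rewrite /gmap (fsum1 (i0 := d)) -/(gterm _ _); last first.
  move=> e ed; rewrite -/(gterm e v) gtermE big1 // => q _.
  by rewrite (weight_part_neq hv ed) linear0 (conj_linear0 phiP) scaler0.
rewrite gtermE (bigD1 p) //= big1 ?addr0 => [|q qp].
  by rewrite (weight_part_id hv) parity_part_id.
by rewrite (weight_part_id hv) (parity_part_neq pv qp) (conj_linear0 phiP) scaler0.
Qed.

Lemma gmap_homog_in d p v : homog cs d p v -> homog cs d p (g v).
Proof. by move=> hv; rewrite (gmap_homog hv); apply: homogZ; exact: phi_homog. Qed.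

Lemma gmap_weight d v : has_weight cs (half d) v -> has_weight cs (half d) (g v).
Proof.
move=> /homog_split [v0 [v1 [h0 h1 ->]]]; rewrite (conj_linearD gmapP).
by apply: has_weightD; [exact: (gmap_homog_in h0).1|exact: (gmap_homog_in h1).1].
Qed.

Lemma gmap_qprim d p q : qprim cs d p q -> qprim cs d p (g q).
Proof.
move=> [hq Lq]; split; first exact: gmap_homog_in.
by rewrite (gmap_homog hq) linearZ /= -phi_L Lq (conj_linear0 phiP) scaler0.
Qed.

Lemma conj_Ni : (- 'i%C)^* = 'i%C :> C.
Proof. by apply/eqP; rewrite eq_complex /= oppr0 opprK !eqxx. Qed.

Lemma mul_ii : 'i%C * 'i%C = -1 :> C.
Proof. by apply/eqP; rewrite eq_complex /=; apply/andP; split; apply/eqP; ring. Qed.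

(** The second application conjugates the phase produced by the first, and (- i)^n i^n = 1. *)
Lemma gmapK d p v : homog cs d p v -> g (g v) = v.
Proof.
move=> hv; rewrite (gmap_homog (gmap_homog_in hv)) (gmap_homog hv).
rewrite (conj_linearZ _ _ phiP) (involutionK hphi) scalerA rmorphXn /= conj_Ni.
by rewrite -exprMn mulNr mul_ii opprK expr1n scale1r.
Qed.

(** T raises the weight by one, which multiplies the phase by (- i)^2 = -1. *)
Lemma gmap_transl v : g (T v) = - T (g v).
Proof.
elim/(homog_ind (cs := cs)): v => [u v Hu Hv|d p v hv].
  by rewrite linearD !(conj_linearD gmapP) Hu Hv linearD opprD.
rewrite (gmap_homog (homog_transl hv)) (gmap_homog hv) phi_transl linearZ /=.
by rewrite !addSn !exprS mulrA mulrNN mul_ii mulN1r scaleNr.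
Qed.

Lemma gmap_vac c : g (c *: vac) = c^* *: vac.
Proof.
rewrite (conj_linearZ _ _ gmapP); congr (_ *: _).
rewrite (gmap_homog (d := 0) (p := false)) ?expr0 ?scale1r ?phi_vac //.
by split; [rewrite mul0r; exact: has_weight_vac|exact: vacuum_even].
Qed.

Local Notation L1 := (vprod VA L 2).

Lemma has_weight_iter_L1 k h v : has_weight cs h v ->
  has_weight cs (h - k%:R) (iter k L1 v).
Proof.
move=> hv; elim: k => [|k IH]; first by rewrite subr0.
by rewrite -natr1 opprD addrA; exact: has_weight_L1.
Qed.

Lemma iter_L1_eq0 d k v : has_weight cs (half d) v -> (d < k)%N ->
  iter k L1 v = 0.
Proof.
move=> hv lt_dk; apply: has_weight_lt0 (has_weight_iter_L1 k hv) _.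
rewrite subr_lt0 ltr_pdivrMr // -natrM ltr_nat; apply: (leq_trans lt_dk).
by rewrite leq_pmulr.
Qed.

Lemma iter_L1P k : linear (iter k L1).
Proof.
by elim: k => // k IH c u v; rewrite !iterS -linearP; congr L1; exact: IH.
Qed.
HB.instance Definition _ k := GRing.isLinear.Build C V V _ (iter k L1) (iter_L1P k).

Definition aterm (j : int) v (x : nat * nat) : V :=
  if x.1%:Z - x.2%:Z == j then (x.1`!%:R)^-1 *: iter x.1 L1 (wpart x.2 (g v))
  else 0.

Lemma AcoefE v j : Acoef cs phi v j = \sum_(x \in [set: nat * nat]) aterm j v x.
Proof.
rewrite /Acoef fsbig_mkcond; apply: eq_fsbigr => x _; rewrite /patch /aterm.
by congr (if _ then _ else _); apply/idP/eqP; rewrite inE.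
Qed.

Lemma atermP j x : conj_linear (fun v => aterm j v x).
Proof.
move=> c u v; rewrite /aterm; case: eqP => _; last by rewrite scaler0 addr0.
by rewrite gmapP !linearP.
Qed.

Lemma aterm_homog j d v x : has_weight cs (half d) v ->
  x != ((absz (j + d%:Z)), d) -> aterm j v x = 0.
Proof.
move=> hv; case: x => k e ke; rewrite /aterm /=; case: eqP => // jE.
have [ed|ed] := eqVneq e d; last first.
  by rewrite (weight_part_neq (gmap_weight hv) ed) linear0 scaler0.
by move: ke; rewrite -jE ed subrK absz_nat eqxx.
Qed.

Lemma aterm_finite j v : finite_set [set x | aterm j v x != 0].
Proof.
elim/(homog_ind (cs := cs)): v => [u v Hu Hv|d p v [hv _]].
  apply: finite_support_sub (finite_supportD Hu Hv) => x.
  by rewrite (conj_linearD (atermP j x)).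
apply: (finite_support_mem (r := [:: ((absz (j + d%:Z)), d)])) => x.
by rewrite inE; exact: aterm_homog.
Qed.

Lemma AcoefP j : conj_linear (fun v => Acoef cs phi v j).
Proof.
move=> c u v; rewrite !AcoefE.
exact: (fsum_semilinear (phi := fun w => c^* *: w) (scaler0 _ _) (scalerDr _)
  (aterm_finite j u) (aterm_finite j v) (fun x => atermP j x c u v)).
Qed.

(** A vector of weight d/2 contributes only through the pair (j + d, d). For j + d < 0 [absz]
    returns a meaningless index, at which the test in [aterm] fails. *)
Lemma Acoef_weight d v j : has_weight cs (half d) v ->
  Acoef cs phi v j = if 0 <= j + d%:Z then
    ((absz (j + d%:Z))`!%:R)^-1 *: iter (absz (j + d%:Z)) L1 (g v) else 0.
Proof.
move=> hv; rewrite AcoefE (fsum1 (i0 := ((absz (j + d%:Z)), d))); last first.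
  by move=> x; exact: aterm_homog.
rewrite /aterm /= (weight_part_id (gmap_weight hv)).
by congr (if _ then _ else _); apply/eqP/idP; lia.
Qed.

Lemma Acoef_finite v : finite_set [set j | Acoef cs phi v j != 0].
Proof.
elim/(homog_ind (cs := cs)): v => [u v Hu Hv|d p v [hv _]].
  apply: finite_support_sub (finite_supportD Hu Hv) => j.
  by rewrite (conj_linearD (AcoefP j)).
apply: (finite_support_mem (r := [seq k%:Z - d%:Z | k <- iota 0 d.+1])) => j jr.
rewrite (Acoef_weight _ hv); case: ifP => // j0.
rewrite (iter_L1_eq0 (gmap_weight hv)) ?scaler0 //.
rewrite ltnNge; apply: contra jr => jd; apply/mapP; exists (absz (j + d%:Z)).
  by rewrite mem_iota.
by lia.
Qed.

Lemma YAcoef_finite a v m : finite_set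
  [set j : int | vprod VA (Acoef cs phi a j) (m - j - 1) v != 0].
Proof.
apply: finite_support_sub (Acoef_finite a) => j ->.
exact: vprod0l.
Qed.

Lemma YAcoefPl v m : conj_linear (fun a => YAcoef cs phi a v m).
Proof.
move=> c a b; rewrite /YAcoef.
apply: (fsum_semilinear (phi := fun w => c^* *: w) (scaler0 _ _) (scalerDr _)
  (YAcoef_finite a v m) (YAcoef_finite b v m)) => j.
by rewrite (AcoefP j c a b) vprodDl vprodZl.
Qed.

Lemma YAcoefPr a m : linear (fun v => YAcoef cs phi a v m).
Proof.
move=> c u v; rewrite /YAcoef.
apply: (fsum_semilinear (phi := fun w => c *: w) (scaler0 _ _) (scalerDr _)
  (YAcoef_finite a u m) (YAcoef_finite a v m)) => j.
exact: linearP.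
Qed.

(** L_1^k g(a) = 0 for k > d, so any N > d gives the same sum; this freedom lets the expansions of
    different vectors be compared. *)
Lemma YAcoef_weight d N a v m : has_weight cs (half d) a -> (d < N)%N ->
  YAcoef cs phi a v m = \sum_(k < N) (k`!%:R)^-1 *:
    Y (iter k L1 (g a)) (m - k%:Z + d%:Z - 1) v.
Proof.
move=> ha lt_dN; rewrite /YAcoef.
rewrite (fsum_seq (r := [seq k%:Z - d%:Z | k <- iota 0 N])).
- rewrite big_map -[N in iota 0 N]subn0 -/(index_iota 0 N) big_mkord.
  apply: eq_bigr => k _; rewrite (Acoef_weight _ ha) subrK absz_nat /= vprodZl.
  by congr (_ *: Y _ _ _); lia.
- by rewrite map_inj_uniq ?iota_uniq // => x y; lia.
- move=> j jr; rewrite (Acoef_weight _ ha); case: ifP => j0; last exact: vprod0l.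
  rewrite (iter_L1_eq0 (gmap_weight ha)) ?scaler0 ?vprod0l //.
  rewrite ltnNge; apply: contra jr => jd; apply/mapP; exists (absz (j + d%:Z)).
    by rewrite mem_iota; lia.
  by lia.
Qed.

End Involution.

(** * Adjoint modes *)

Section Adjoint.
Variables (R : realType) (V : lmodType R[i]) (VA : vertexAlgebra V).
Variable cs : conformalStructure VA.
Local Notation C := (R[i]).
Local Notation Y := (vprod VA).
Local Notation vac := (vacuum VA).
Local Notation T := (transl VA).
Local Notation L := (confL cs).
Local Notation half d := (d%:R / 2 : C).
Local Notation wpart := (weight_part cs).
Variable phi : V -> V.
Hypothesis hphi : conj_linear_involution cs phi.
Local Notation g := (gmap cs phi).

Local Notation L1 := (vprod VA L 2).

Lemma gbinM_fact (x : int) k :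
  k.+1`!%:R * gbin C x k.+1 = k`!%:R * gbin C x k * (x - k%:Z)%:~R.
Proof.
have f0 n : n`!%:R != 0 :> C by rewrite pnatr_eq0 -lt0n fact_gt0.
rewrite /gbin big_ord_recr /= ![_`!%:R * _]mulrC !divfK //.
Qed.

(** As L_1 b = 0, each L_1 turns a_(n) b into (d - 2 - n) a_(n+1) b. The product of these factors is
    a falling factorial. *)
Lemma iter_L1_qprim d p d' p' a b k (j : int) :
  qprim cs d p a -> qprim cs d' p' b ->
  iter k L1 (Y a j b)
  = (k`!%:R * gbin C (d%:Z - 2 - j) k) *: Y a (j + k%:Z) b.
Proof.
move=> [[ha _] La] [_ Lb]; elim: k => [|k IH].
  by rewrite gbin0 mulr1 scale1r addr0.
rewrite iterS IH linearZ /= gbinM_fact -[RHS]scalerA; congr (_ *: _).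
have := confL2_comm cs a (j + k%:Z) b.
rewrite Lb linear0 subr0 La vprod0l add0r ha vprodZl scalerA -scalerBl => ->.
rewrite mulrC divfK ?pnatr_eq0 //; congr (_ *: Y _ _ _); last by lia.
by rewrite -[d%:R]/((d%:Z)%:~R) -intrB; congr (_%:~R); lia.
Qed.

(** The adjoint of the mode [a_(n)]. *)
Definition adj (a : V) (n : int) (v : V) : V := YAcoef cs phi a v (- n - 1).

Lemma YAcoef_adj a v m : YAcoef cs phi a v m = adj a (- m - 1) v.
Proof. by rewrite /adj; congr (YAcoef _ _ _ _ _); lia. Qed.

Lemma adjPl n v : conj_linear (fun a => adj a n v).
Proof. exact: (YAcoefPl hphi). Qed.

Lemma adjPr a n : linear (adj a n).
Proof. exact: (YAcoefPr hphi). Qed.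

Lemma adj_weight d N a n v : has_weight cs (half d) a -> (d < N)%N ->
  adj a n v = \sum_(k < N) (k`!%:R)^-1 *:
    Y (iter k L1 (g a)) (d%:Z - 2 - n - k%:Z) v.
Proof.
move=> ha dN; rewrite /adj (YAcoef_weight hphi _ _ ha dN).
by apply: eq_bigr => k _; congr (_ *: Y _ _ _); lia.
Qed.

Lemma gmap_L1 v : L1 (g v) = - g (L1 v).
Proof.
elim/(homog_ind (cs := cs)): v => [u v Hu Hv|d p v hv].
  by rewrite !linearD !(conj_linearD (gmapP hphi)) linearD /= Hu Hv opprD.
case: d => [|[|d]] in hv *.
- by rewrite !(@L1_low _ _ _ _ 0) ?(conj_linear0 (gmapP hphi)) ?oppr0 //;
    [exact: hv.1|exact: (gmap_homog_in hphi hv).1].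
- by rewrite !(@L1_low _ _ _ _ 1) ?(conj_linear0 (gmapP hphi)) ?oppr0 //;
    [exact: hv.1|exact: (gmap_homog_in hphi hv).1].
- rewrite (gmap_homog hphi hv) (gmap_homog hphi (homog_L1 hv)) linearZ /= (phi_L hphi).
  by rewrite !addSn !exprS mulrA mulrNN mul_ii mulN1r scaleNr.
Qed.

Lemma adj_quasiprimary d q n v : has_weight cs (half d) q -> L1 q = 0 ->
  adj q n v = Y (g q) (d%:Z - 2 - n) v.
Proof.
move=> hq Lq; rewrite (adj_weight _ _ hq (ltnSn d)) big_ord_recl /=.
rewrite fact0 invr1 scale1r subr0 big1 ?addr0 // => k _.
have Lg : L1 (g q) = 0 by rewrite gmap_L1 Lq (conj_linear0 (gmapP hphi)) oppr0.
rewrite -iterS iterSr Lg (_ : iter _ _ 0 = 0) ?vprod0l ?scaler0 //.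
by elim: (nat_of_ord k) => //= i ->; rewrite linear0.
Qed.

Lemma adj_qprim d p q n v : qprim cs d p q ->
  adj q n v = Y (g q) (d%:Z - 2 - n) v.
Proof. by move=> [[hq _] Lq]; exact: adj_quasiprimary. Qed.

(** L_1^k T g(a) is T L_1^k g(a) plus a multiple of L_1^(k-1) g(a). After a shift of the index in
    the second part, the coefficients combine term by term. *)
Lemma adj_transl a n v : adj (T a) n v = - n%:~R *: adj a (n - 1) v.
Proof.
elim/(homog_ind (cs := cs)): a => [a b Ha Hb|d p a ha].
  by rewrite linearD !(conj_linearD (adjPl _ _)) Ha Hb scalerDr.
have hga := gmap_weight hphi ha.1.
rewrite (adj_weight (N := d.+3) _ _ (homog_transl ha).1) //.
rewrite (adj_weight (N := d.+2) _ _ ha.1) // (gmap_transl hphi).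
pose X k := Y (iter k L1 (g a)) (d%:Z - n - 1 - k%:Z) v.
have XE k : Y (iter k L1 (- T (g a))) (d.+2%:Z - 2 - n - k%:Z) v
  = - ((- (d%:Z - n - k%:Z)%:~R) *: X k + (k%:R * (d%:R - k%:R + 1)) *: X k.-1).
  rewrite linearN /= vprodNl (iter_L1_transl _ hga) vprodDl vprodZl (vprod_transl cs).
  case: k => [|k].
    rewrite !mul0r !scale0r; congr (- (_ *: Y _ _ _ + _)); first congr (- _%:~R).
      by lia.
    by rewrite /=; lia.
  congr (- (_ *: Y _ _ _ + _ *: Y _ _ _)); first congr (- _%:~R).
  - by lia.
  - by lia.
  - by rewrite mulrCA divff ?pnatr_eq0 // mulr1.
  - by rewrite /=; lia.
rewrite (eq_bigr (fun k : 'I_d.+3 =>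
    (k`!%:R^-1 * (d%:Z - n - k%:Z)%:~R) *: X k
    - (k`!%:R^-1 * (k%:R * (d%:R - k%:R + 1))) *: X k.-1)); last first.
  by move=> k _; rewrite XE; lmod_ring.
(* The shift loses nothing: the top term of the first sum is 0 since L_1^(d+2) g(a) = 0, the bottom
   term of the second has the factor k = 0. *)
rewrite sumrB big_ord_recr /= {2}/X (iter_L1_eq0 hga) //.
rewrite vprod0l scaler0 addr0 [X in _ - X]big_ord_recl /= mul0r mulr0 scale0r add0r.
rewrite -sumrB scaler_sumr; apply: eq_bigr => k _.
rewrite /bump /= add1n /=.
rewrite (_ : d%:Z - 2 - (n - 1) - k%:Z = d%:Z - n - 1 - k%:Z); last by lia.
rewrite -/(X k) -scalerBl scalerA; congr (_ *: _).
have k0 : k`!%:R != 0 :> C by rewrite pnatr_eq0 -lt0n fact_gt0.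
have k1 : k.+1%:R != 0 :> C by rewrite pnatr_eq0.
rewrite factS natrM invfM !intrB -!pmulrn -!natr1.
move: k0 k1; rewrite -natr1.
move: (k`!%:R : C) (k%:R : C) (d%:R : C) (n%:~R : C) => a1 b1 c1 e1 a0 b0.
by field; rewrite a0 b0.
Qed.

Lemma homog_vprod_eq0 d p d' p' a b (j : nat) :
  homog cs d p a -> homog cs d' p' b -> (d + d' < j.+1.*2)%N -> Y a j b = 0.
Proof.
move=> [ha _] [hb _] lt_j; apply: has_weight_lt0 (has_weight_vprod j ha hb) _.
rewrite -addrA -opprD -[j%:~R]/(j%:R) natr1 subr_lt0 -mulrDl -natrD.
by rewrite ltr_pdivrMr // -natrM ltr_nat muln2.
Qed.

Lemma homog_vprod d p d' p' a b (j : nat) : homog cs d p a ->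
  homog cs d' p' b -> (j.+1.*2 <= d + d')%N ->
  homog cs (d + d' - j.+1.*2) (p (+) p') (Y a j b).
Proof.
move=> [ha pa] [hb pb] le_j; split; last exact: vprod_parity.
rewrite (_ : half _ = half d + half d' - j%:~R - 1).
  exact: has_weight_vprod.
rewrite natrB // -muln2 natrM mulrBl mulfK ?pnatr_eq0 // natrD mulrDl.
by rewrite -[j%:~R]/(j%:R) -(natr1 j) opprD addrA.
Qed.

(** The doubled weight of a_(j)b is d + d' - 2(j + 1), and p (+) p' = p + p' - 2pp'. The two even
    surpluses in the exponent of - i produce the two signs. *)
Lemma gmap_vprod d p d' p' a b (j : nat) :
  homog cs d p a -> homog cs d' p' b ->
  g (Y a j b) = (- (-1) ^+ j * (-1) ^+ (p && p')) *: Y (g a) j (g b).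
Proof.
move=> ha hb; have [lt_j|le_j] := ltnP (d + d') j.+1.*2.
  rewrite (homog_vprod_eq0 ha hb lt_j) (conj_linear0 (gmapP hphi)).
  by rewrite (homog_vprod_eq0 (gmap_homog_in hphi ha) (gmap_homog_in hphi hb) lt_j) scaler0.
rewrite (gmap_homog hphi (homog_vprod ha hb le_j)) (gmap_homog hphi ha) (gmap_homog hphi hb).
rewrite (involution_vprod hphi) vprodZl [Y (phi a) j (_ *: _)]linearZ /= !scalerA.
congr (_ *: _).
set e := (d + d' - j.+1.*2)%N; have dE : (d + d' = e + j.+1.*2)%N by rewrite subnK.
rewrite -mulrA -exprD addnACA dE.
have -> : (p + p' = (p (+) p') + (p && p').*2)%N by case: (p) (p') => [] [].
have iX n : (- 'i%C) ^+ n.*2 = (-1) ^+ n :> C.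
  by rewrite -mul2n exprM expr2 mulrNN mul_ii.
rewrite addnACA -doubleD [in RHS]exprD iX [(-1) ^+ (_ + _)]exprD exprS.
have pp : (-1) ^+ (p && p') * (-1) ^+ (p && p') = 1 :> C.
  by rewrite -exprD addnn -mul2n exprM sqrrN !expr1n.
have jj : (-1) ^+ j * (-1) ^+ j = 1 :> C.
  by rewrite -exprD addnn -mul2n exprM sqrrN !expr1n.
move: pp jj; move: ((-1) ^+ (p && p')) ((-1) ^+ j) ((- 'i) ^+ _) => x y z xx yy.
rewrite (_ : _ * _ = z * (x * x) * (y * y)); last by ring.
by rewrite xx yy !mulr1.
Qed.

(** On the left stands a supercommutator of modes of g(a) and g(b), expanded with C(d - 2 - m, l).
    On the right the adjoint of a_(j)b brings in L_1^k (g(a)_(j) g(b)), a multiple of g(a)_(j+k)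
    g(b). Collecting l = j + k leaves the sum of (-1)^j C(m, j) C(d - 2 - j, l - j), evaluated by
    [gbin_vandermonde]. *)
Lemma adj_commutator d p d' p' a b : qprim cs d p a -> qprim cs d' p' b ->
  exists N0, forall N, (N0 <= N)%N -> forall (m n : int) v,
    adj b n (adj a m v) - (-1) ^+ (p && p') *: adj a m (adj b n v)
    = \sum_(j < N) gbin C m j *: adj (Y a j b) (m + n - j%:Z) v.
Proof.
move=> ha hb; have hga := gmap_qprim hphi ha; have hgb := gmap_qprim hphi hb.
have [N0 comm] := commutator_formula hga.1.2 hgb.1.2.
(* With N >= d + d' the truncation at N - j still exceeds the doubled weight of a_(j)b, so no term
   of its adjoint is lost. *)
exists (N0 + (d + d'))%N => N le_N m n v.
set s := (-1) ^+ (p && p') in comm *.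
have ss : s * s = 1 by rewrite /s -exprD addnn -mul2n exprM sqrrN !expr1n.
rewrite !(adj_qprim _ _ ha) !(adj_qprim _ _ hb).
set m' := d%:Z - 2 - m; set n' := d'%:Z - 2 - n.
have := comm N (leq_trans (leq_addr _ _) le_N) m' n' v.
rewrite -/m' -/n'.
pose X l := Y (Y (g a) l%:Z (g b)) (m' + n' - l%:Z) v.
move=> E.
have {}E : Y (g b) n' (Y (g a) m' v) - s *: Y (g a) m' (Y (g b) n' v)
  = - s *: \sum_(l < N) gbin C m' l *: X l.
  by rewrite -E scalerBr scalerA mulNr ss; lmod_ring.
rewrite {}E.
have adjE (j : 'I_N) : adj (Y a j b) (m + n - j%:Z) v
    = \sum_(k < N - j) (- (-1) ^+ j * s * gbin C (d%:Z - 2 - j%:Z) k) *: X (j + k)%N.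
  have [lt_j|le_j] := ltnP (d + d') j.+1.*2.
    rewrite (homog_vprod_eq0 ha.1 hb.1 lt_j) (conj_linear0 (adjPl _ _)).
    rewrite big1 // => k _; rewrite /X (homog_vprod_eq0 hga.1 hgb.1) ?vprod0l ?scaler0 //.
    by lia.
  rewrite (adj_weight (N := N - j) _ _ (homog_vprod ha.1 hb.1 le_j).1); last by lia.
  apply: eq_bigr => k _; rewrite (gmap_vprod _ ha.1 hb.1) linearZ /=.
  rewrite (iter_L1_qprim _ _ hga hgb) scalerA vprodZl scalerA; congr (_ *: _).
    have k0 : k`!%:R != 0 :> C by rewrite pnatr_eq0 -lt0n fact_gt0.
    by move: k0; rewrite -/s; move: (k`!%:R : C) => x x0; field.
  by congr (Y (Y _ _ _) _ _); lia.
rewrite [RHS](eq_bigr (fun j : 'I_N => \sum_(k < N - j)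
    (gbin C m j * (- (-1) ^+ j * s * gbin C (d%:Z - 2 - j%:Z) (j + k - j))) *: X (j + k)%N));
  last first.
  move=> j _; rewrite adjE scaler_sumr; apply: eq_bigr => k _.
  by rewrite scalerA addKn.
rewrite (sum_triangle (fun j l =>
  (gbin C m j * (- (-1) ^+ j * s * gbin C (d%:Z - 2 - j%:Z) (l - j))) *: X l)).
rewrite scaler_sumr; apply: eq_bigr => l _.
rewrite -scaler_suml scalerA; congr (_ *: _).
rewrite /m' -(gbin_vandermonde C m) mulr_sumr; apply: eq_bigr => j _.
ring.
Qed.

End Adjoint.

(** * The invariant form *)

Section Form.
Variables (R : realType) (V : lmodType R[i]) (VA : vertexAlgebra V).
Variable cs : conformalStructure VA.
Local Notation C := (R[i]).
Local Notation Y := (vprod VA).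
Local Notation vac := (vacuum VA).
Local Notation T := (transl VA).
Local Notation L := (confL cs).
Local Notation half d := (d%:R / 2 : C).
Local Notation wpart := (weight_part cs).
Variable phi : V -> V.
Hypothesis hphi : conj_linear_involution cs phi.
Local Notation g := (gmap cs phi).

Local Notation L1 := (vprod VA L 2).


Local Notation adj := (adj cs phi).
Local Notation vev := (vev cs).
Hypothesis hV1 : forall v, weight cs 1 v -> quasiprimary cs 1 v.

HB.instance Definition _ a n :=
  GRing.isLinear.Build C V V _ (adj a n) (adjPr hphi a n).

Lemma conj_int (z : int) : (z%:~R : C)^* = z%:~R.
Proof. exact: rmorph_int. Qed.

Lemma conj_gbin z k : (gbin C z k)^* = gbin C z k.
Proof.
rewrite /gbin rmorphM fmorphV rmorph_nat rmorph_prod; congr (_ * _).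
by apply: eq_bigr => i _; exact: conj_int.
Qed.

Lemma conj_sign (b : bool) : ((-1) ^+ b : C)^* = (-1) ^+ b.
Proof. by rewrite rmorphXn rmorphN1. Qed.

(** * Reflection identities for words of one, two and three letters *)

Definition mirror (x x' : V) : Prop := vev x = (vev x')^*.

Lemma mirror0 x x' : vev x = 0 -> vev x' = 0 -> mirror x x'.
Proof. by rewrite /mirror => -> ->; rewrite conjC0. Qed.

Lemma mirrorP c x x' y y' : mirror x x' -> mirror y y' ->
  mirror (c *: x + y) (c^* *: x' + y').
Proof.
rewrite /mirror => hx hy; rewrite !linearP /= hx hy rmorphD rmorphM.
by rewrite /= conjCK.
Qed.

Lemma mirror_sum N (c : nat -> C) (x x' : nat -> V) : (forall j, (c j)^* = c j) ->
  (forall j, mirror (x j) (x' j)) ->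
  mirror (\sum_(j < N) c j *: x j) (\sum_(j < N) c j *: x' j).
Proof.
move=> cc xx; elim: N => [|N IH]; first by rewrite !big_ord0; apply: mirror0; rewrite linear0.
by rewrite !big_ord_recr /= addrC [X in mirror _ X]addrC -{2}cc; exact: mirrorP.
Qed.

Lemma weight0_eq q : has_weight cs (half 0) q -> exists c, q = c *: vac.
Proof.
rewrite mul0r => hq; apply/(weight0_vacuum cs).
by rewrite -[eigenspaceL0 _ _ _ _]/(weight cs 0 q) weightE rmorph0.
Qed.

Lemma vprod_vac c n v : Y (c *: vac) n v = if n == -1 then c *: v else 0.
Proof. by rewrite vprodZl vacuum_left; case: eqP => // _; rewrite scaler0. Qed.

Lemma vac_homog c : homog cs 0 false (c *: vac).
Proof.
apply: homogZ; split; last exact: vacuum_even.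
by rewrite mul0r; exact: has_weight_vac.
Qed.

Lemma adj_vac c n v : adj (c *: vac) n v = if n == -1 then c^* *: v else 0.
Proof.
rewrite (adj_qprim hphi (d := 0) (p := false)); last first.
  by split; [exact: vac_homog|rewrite linearZ /= L1_vac scaler0].
rewrite (gmap_vac hphi) vprod_vac; congr (if _ then _ else _).
by apply/eqP/eqP; lia.
Qed.

Section ModesOfPositiveWeight.
Variables (d : nat) (p : bool) (q : V).
Hypothesis hq : qprim cs d.+1 p q.

(** The doubled weight is d + 1, so n < 0 falls in the range n <= d - 1 of [vev_qprim]. For weight 0
    this fails at n = -1, where the vacuum acts as the identity. *)
Lemma vev_creation n w : n < 0 -> vev (Y q n w) = 0.
Proof. by move=> n0; apply: (vev_qprim hV1 _ hq); lia. Qed.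

Lemma adj_creation_vac n : n < 0 -> adj q n vac = 0.
Proof. by move=> n0; rewrite (adj_qprim hphi _ _ hq) vacuum_right //; lia. Qed.

Lemma vev_adj_annihilation n w : 0 <= n -> vev (adj q n w) = 0.
Proof.
move=> n0; rewrite (adj_qprim hphi _ _ hq).
by apply: (vev_qprim hV1 _ (gmap_qprim hphi hq)); lia.
Qed.

End ModesOfPositiveWeight.

(** Reduces one letter of a reflection identity to the quasiprimary case: the two words depend on it
    linearly and conjugate linearly, and respond to T with the same real factor - n. *)
Lemma mirror_ind (X X' : V -> int -> V) :
  (forall n, linear (X ^~ n)) -> (forall n, conj_linear (X' ^~ n)) ->
  (forall a n, X (T a) n = - n%:~R *: X a (n - 1)) ->
  (forall a n, X' (T a) n = - n%:~R *: X' a (n - 1)) ->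
  (forall d p q, qprim cs d p q -> forall n, mirror (X q n) (X' q n)) ->
  forall a n, mirror (X a n) (X' a n).
Proof.
move=> XP XP' XT XT' Xq; elim/(quasiprimary_ind hV1) => [n|c u v Hu Hv n|v Hv n|d p q hq n].
- have X0 : X 0 n = 0.
    by have := XP n (-1) 0 0; rewrite /= scaler0 add0r scaleN1r addNr.
  by apply: mirror0; rewrite ?X0 ?(conj_linear0 (XP' n)) linear0.
- by rewrite (XP n c u v) (XP' n c u v); exact: mirrorP.
- have := mirrorP (- n%:~R) (Hv (n - 1)) (mirror0 (linear0 _) (linear0 _)).
  by rewrite XT XT' !addr0 rmorphN /= conj_int.
- exact: Xq hq n.
Qed.

Lemma mirror1 a n : mirror (Y a n vac) (adj a n vac).
Proof.
apply: (mirror_ind (X := fun a n => Y a n vac) (X' := fun a n => adj a n vac)).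
- by move=> m; exact: vprod_linearl.
- by move=> m; exact: (adjPl hphi).
- by move=> b m; exact: (vprod_transl cs).
- by move=> b m; exact: (adj_transl hphi).
move=> [|d] p q hq m.
  have [c ->] := weight0_eq hq.1.1; rewrite vprod_vac adj_vac /mirror.
  by case: eqP => _; rewrite ?linear0 ?conjC0 // !linearZ /= vev_vac !mulr1 conjCK.
have [m0|m0] := leP 0 m.
  by apply: mirror0; [rewrite vacuum_right // linear0|exact: (vev_adj_annihilation hq)].
by apply: mirror0; [exact: (vev_creation hq)|rewrite (adj_creation_vac hq) // linear0].
Qed.

Lemma adj_linl c a b n v : adj (c *: a + b) n v = c^* *: adj a n v + adj b n v.
Proof. exact: (adjPl hphi). Qed.

Lemma mirrorD x x' y y' : mirror x x' -> mirror y y' -> mirror (x + y) (x' + y').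
Proof.
by move=> hx hy; have := mirrorP 1 hx hy; rewrite conjC1 !scale1r.
Qed.

Lemma mirrorZ c x x' : c^* = c -> mirror x x' -> mirror (c *: x) (c *: x').
Proof.
move=> cc hx; have := mirrorP c hx (mirror0 (linear0 _) (linear0 _)).
by rewrite !addr0 cc.
Qed.

(** Both expansions have the same length and the same real coefficients, so they can be reflected
    term by term. *)
Lemma commutators d p d' p' a b : qprim cs d p a -> qprim cs d' p' b ->
  exists N, forall m n v,
    Y a m (Y b n v) = \sum_(j < N) gbin C m j *: Y (Y a j b) (m + n - j%:Z) v
      + (-1) ^+ (p && p') *: Y b n (Y a m v)
    /\ adj b n (adj a m v) =
      \sum_(j < N) gbin C m j *: adj (Y a j b) (m + n - j%:Z) v
      + (-1) ^+ (p && p') *: adj a m (adj b n v).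
Proof.
move=> ha hb; have [N1 c1] := commutator_formula ha.1.2 hb.1.2.
have [N2 c2] := adj_commutator hphi ha hb.
exists (N1 + N2)%N => m n v.
by rewrite -(c1 _ (leq_addr _ _)) -(c2 _ (leq_addl _ _)) !subrK.
Qed.

Lemma mirror2 a b m n : mirror (Y a m (Y b n vac)) (adj b n (adj a m vac)).
Proof.
move: a m; apply: (mirror_ind (X := fun a m => Y a m (Y b n vac))
  (X' := fun a m => adj b n (adj a m vac))).
- by move=> m; exact: vprod_linearl.
- by move=> m c u v; rewrite adj_linl linearP.
- by move=> a m; exact: (vprod_transl cs).
- by move=> a m; rewrite (adj_transl hphi) linearZ.
move=> d p a ha m; move: b n.
apply: (mirror_ind (X := fun b n => Y a m (Y b n vac))
  (X' := fun b n => adj b n (adj a m vac))).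
- by move=> n c u v /=; rewrite vprodDl vprodZl linearP.
- by move=> n c u v; exact: adj_linl.
- by move=> b n; rewrite (vprod_transl cs) linearZ.
- by move=> b n; exact: (adj_transl hphi).
move=> [|d'] p' b hb n.
  have [c ->] := weight0_eq hb.1.1; rewrite vprod_vac adj_vac.
  case: eqP => _; last by apply: mirror0; rewrite ?linear0.
  rewrite linearZ /= -[X in mirror X]addr0 -[X in mirror _ X]addr0.
  by apply: mirrorP (mirror1 a m) (mirror0 (linear0 _) (linear0 _)).
have [n0|n0] := leP 0 n.
  by apply: mirror0; [rewrite vacuum_right // !linear0|exact: (vev_adj_annihilation hb)].
have [N comm] := commutators ha hb; have [-> ->] := comm m n vac.
apply: mirrorD.
  by apply: (@mirror_sum _ (gbin C m)
    (fun j : nat => Y (Y a j b) (m + n - j%:Z) vac)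
    (fun j : nat => adj (Y a j b) (m + n - j%:Z) vac)) => j;
    [exact: conj_gbin|exact: mirror1].
(* The transposed words both have value 0: b_(n) stands leftmost in one, its adjoint acts on the
   vacuum in the other. *)
rewrite (adj_creation_vac hb n0); apply: mirrorZ; first exact: conj_sign.
by apply: mirror0; [exact: (vev_creation hb)|rewrite !linear0].
Qed.

Lemma mirror3 a b c m n k :
  mirror (Y a m (Y b n (Y c k vac))) (adj c k (adj b n (adj a m vac))).
Proof.
move: a m; apply: (mirror_ind (X := fun a m => Y a m (Y b n (Y c k vac)))
  (X' := fun a m => adj c k (adj b n (adj a m vac)))).
- by move=> m; exact: vprod_linearl.
- by move=> m z u v; rewrite adj_linl !linearP.
- by move=> a m; exact: (vprod_transl cs).
- by move=> a m; rewrite (adj_transl hphi) !linearZ.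
move=> d p a ha m; move: b n.
apply: (mirror_ind (X := fun b n => Y a m (Y b n (Y c k vac)))
  (X' := fun b n => adj c k (adj b n (adj a m vac)))).
- by move=> n z u v /=; rewrite vprodDl vprodZl linearP.
- by move=> n z u v; rewrite adj_linl linearP.
- by move=> b n; rewrite (vprod_transl cs) linearZ.
- by move=> b n; rewrite (adj_transl hphi) linearZ.
move=> d' p' b hb n; move: c k.
apply: (mirror_ind (X := fun c k => Y a m (Y b n (Y c k vac)))
  (X' := fun c k => adj c k (adj b n (adj a m vac)))).
- by move=> k z u v /=; rewrite vprodDl vprodZl !linearP.
- by move=> k z u v; exact: adj_linl.
- by move=> c k; rewrite (vprod_transl cs) !linearZ.
- by move=> c k; exact: (adj_transl hphi).
move=> [|e] r c hc k.
  have [z ->] := weight0_eq hc.1.1; rewrite vprod_vac adj_vac.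
  case: eqP => _; last by apply: mirror0; rewrite ?linear0.
  rewrite !linearZ /= -[X in mirror X]addr0 -[X in mirror _ X]addr0.
  by apply: mirrorP (mirror2 a b m n) (mirror0 (linear0 _) (linear0 _)).
have [k0|k0] := leP 0 k.
  by apply: mirror0; [rewrite vacuum_right // !linear0|exact: (vev_adj_annihilation hc)].
have [N1 bc] := commutators hb hc; have [N2 ac] := commutators ha hc.
have [-> _] := bc n k vac; have [_ ->] := bc n k (adj a m vac).
rewrite linearD linearZ linear_sum /=.
(* The letter c now passes a: in front of b_(n) 1 in the word, but in front of the vacuum, inside
   the adjoint of b_(n), in the reflected word. *)
have [-> _] := ac m k (Y b n vac); have [_ ->] := ac m k vac.
rewrite (adj_creation_vac hc k0) !linear0 addr0 [adj b n _]linear_sum.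
apply: mirrorD.
  under eq_bigr do rewrite linearZ /=.
  by apply: (@mirror_sum _ (gbin C n)
    (fun j : nat => Y a m (Y (Y b j c) (n + k - j%:Z) vac))
    (fun j : nat => adj (Y b j c) (n + k - j%:Z) (adj a m vac))) => j;
    [exact: conj_gbin|exact: mirror2].
apply: mirrorZ; first exact: conj_sign.
rewrite -[X in mirror _ X]addr0; apply: mirrorD; last first.
  apply: mirror0; last exact: linear0.
  by rewrite linearZ /= (vev_creation hc _ k0) mulr0.
under [X in mirror _ X]eq_bigr do rewrite linearZ /=.
by apply: (@mirror_sum _ (gbin C m)
    (fun j : nat => Y (Y a j c) (m + k - j%:Z) (Y b n vac))
    (fun j : nat => adj b n (adj (Y a j c) (m + k - j%:Z) vac))) => j;
  [exact: conj_gbin|exact: mirror2].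
Qed.

(** The first equation uses that g is an involution and that n -> d - 2 - n is one. *)
Lemma adjK d p q n w : qprim cs d p q ->
  Y q n w = adj (g q) (d%:Z - 2 - n) w /\ adj q n w = Y (g q) (d%:Z - 2 - n) w.
Proof.
move=> hq; split; last exact: (adj_qprim hphi n w hq).
rewrite (adj_qprim hphi _ _ (gmap_qprim hphi hq)) (gmapK hphi hq.1).
by congr (Y q _ w); lia.
Qed.

Lemma mirror_sym x x' : mirror x x' -> mirror x' x.
Proof. by rewrite /mirror => ->; rewrite conjCK. Qed.

(** For quasiprimary a, trading a_(m) for the adjoint of a mode of g(a), and conversely, turns this
    into [mirror2] for g(a) and b. *)
Lemma mirror2_adj a b m n : mirror (adj b n (Y a m vac)) (adj a m (Y b n vac)).
Proof.
move: a m; apply: (mirror_ind (X := fun a m => adj b n (Y a m vac))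
  (X' := fun a m => adj a m (Y b n vac))).
- by move=> m c u v /=; rewrite vprodDl vprodZl linearP.
- by move=> m c u v; exact: adj_linl.
- by move=> a m; rewrite (vprod_transl cs) linearZ.
- by move=> a m; exact: (adj_transl hphi).
move=> d p a ha m; have [-> _] := adjK m vac ha; have [_ ->] := adjK m (Y b n vac) ha.
by apply: mirror_sym; exact: mirror2.
Qed.

Lemma mirror3_adj a b c m n k :
  mirror (adj c k (adj b n (Y a m vac))) (adj a m (Y b n (Y c k vac))).
Proof.
move: a m; apply: (mirror_ind (X := fun a m => adj c k (adj b n (Y a m vac)))
  (X' := fun a m => adj a m (Y b n (Y c k vac)))).
- by move=> m z u v /=; rewrite vprodDl vprodZl !linearP.
- by move=> m z u v; exact: adj_linl.
- by move=> a m; rewrite (vprod_transl cs) !linearZ.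
- by move=> a m; exact: (adj_transl hphi).
move=> d p a ha m; have [-> _] := adjK m vac ha.
have [_ ->] := adjK m (Y b n (Y c k vac)) ha.
by apply: mirror_sym; exact: mirror3.
Qed.

Definition inv_form (v u : V) : C := vev (adj v (-1) u).

Lemma inv_form_hermitian : hermitian_form inv_form.
Proof.
split.
- by move=> v c u w; rewrite /inv_form !linearP.
- by move=> w c u v; rewrite /inv_form adj_linl linearP.
- move=> u v; rewrite /inv_form.
  by have := mirror2_adj v u (-1) (-1); rewrite !vacuum_create.
Qed.

(** With v = v_(-1) 1 and u = u_(-1) 1, and the right side conjugated by Hermitian symmetry, this is
    [mirror3_adj] for v, a, u. *)
Lemma inv_form_invariant : phi_invariant cs phi inv_form.
Proof.
move=> a u v m; rewrite YAcoef_adj.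
have [_ _ form_sym] := inv_form_hermitian.
rewrite [RHS]form_sym /inv_form.
by have := mirror_sym (mirror3_adj v a u (-1) (- m - 1) (-1)); rewrite !vacuum_create.
Qed.

Lemma inv_form_vac : inv_form vac vac = 1.
Proof.
rewrite /inv_form -{1}[vac]scale1r adj_vac eqxx linearZ /= vev_vac.
by rewrite conjC1 mulr1.
Qed.

(** L = L_{-2} 1, and [L_1, L_{-2}] = 3 L_{-1} kills the vacuum, as does L_1. *)
Lemma confL_quasiprimary : Y L 2 L = 0.
Proof.
have := virasoro_eq cs (m := 1) (-2) vac (expr1n _ 3).
rewrite (_ : -2 + 1 = -1 :> int) // vacuum_create (_ : 1 + 1 = 2 :> int) //.
rewrite L1_vac linear0 subr0 => ->.
by rewrite (_ : 1 + -2 + 1 = 0 :> int) // confL0 transl_vacuum scaler0.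
Qed.

Lemma confL_qprim : qprim cs 4 false L.
Proof.
split; last exact: confL_quasiprimary.
split; last exact: confL_even.
have := confL_weight cs; rewrite -[eigenspaceL0 _ _ _ _]/(weight cs 2 L) weightE.
by rewrite rmorph_nat (_ : 4 / 2 = 2 :> C) // -[4]/((2 * 2)%:R) natrM mulfK ?pnatr_eq0.
Qed.

(** L has doubled weight 4 and is even: (- i)^4 = 1 gives g(L) = L, and the index is 4 - 2 - 1 =
    1. *)
Lemma adj_L0 v : adj L 1 v = Y L 1 v.
Proof.
rewrite (adj_qprim hphi 1 v confL_qprim) (gmap_homog hphi confL_qprim.1).
rewrite (involution_confL hphi) vprodZl !exprS expr0 mulr1.
rewrite mulrNN mul_ii; rewrite (_ : _ * _ = 1) ?scale1r //.
by rewrite mulrA mulrNN mul_ii mulrNN mulr1.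
Qed.

(** * Uniqueness of the form and its value on words *)

Section AnyInvariantForm.
Variable B : V -> V -> C.
Hypotheses (B_hermitian : hermitian_form B) (B_invariant : phi_invariant cs phi B).
Hypothesis B_vac : B vac vac = 1.

Lemma B_linear v : scalar (B v). Proof. by have [] := B_hermitian. Qed.
HB.instance Definition _ v := GRing.isLinear.Build C V C _ (B v) (B_linear v).

Lemma B_sym u v : B u v = (B v u)^*. Proof. by have [] := B_hermitian. Qed.

Lemma B_adj a n u v : B v (Y a n u) = B (adj a n v) u.
Proof.
have := B_invariant a u v (- n - 1); rewrite YAcoef_adj.
by rewrite (_ : - (- n - 1) - 1 = n) //; lia.
Qed.

Lemma B_vacl w : B vac w = vev w.
Proof.
elim/(homog_ind (cs := cs)): w => [u v Hu Hv|d p w [hw _]].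
  by rewrite !linearD /= Hu Hv.
case: d hw => [/weight0_eq [c ->]|d hw].
  by rewrite !linearZ /= B_vac vev_vac.
have d0 : half d.+1 != 0 by rewrite mulf_neq0 ?invr_eq0 ?pnatr_eq0.
rewrite (vev_weight hw d0); have := B_adj L 1 w vac.
rewrite adj_L0 vacuum_right // hw linearZ /= (B_sym 0) linear0 conjC0.
by move=> /eqP; rewrite mulf_eq0 (negPf d0) => /eqP.
Qed.

Lemma B_eq v u : B v u = vev (adj v (-1) u).
Proof.
rewrite B_sym -{1}[v](vacuum_create VA) B_adj B_sym conjCK.
exact: B_vacl.
Qed.

Lemma B_mode h q n u w : quasiprimary cs h q -> n + h \is a Num.int ->
  B (mode VA h q n u) w = B u (mode VA h (g q) (- n) w).
Proof.
move=> [hq Lq] /intrP [z nhE].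
(* The zero vector has every weight, so in this case h need not be half-integral. *)
have [->|q0] := eqVneq q 0.
  rewrite (conj_linear0 (gmapP hphi)) /mode !vprod0l linear0.
  by rewrite B_sym linear0 conjC0.
have [/eqP|[d hd]] := has_weight_half hq; first by rewrite (negPf q0).
have hE : h = halfq d by apply: (fmorph_inj (ratr : rat -> C)); rewrite /= hd ratr_halfq.
(* From h = d/2 it follows that - n + h = d - (n + h), again an integer; so the floor in [mode] is
   exact on both sides. *)
have flE : Num.floor (- n + h) = d%:Z - z.
  have -> : - n + h = (d%:Z - z)%:~R.
    rewrite rmorphB /= -nhE hE /halfq -pmulrn; by field.
  exact: intrKfloor.
rewrite /mode flE nhE intrKfloor B_sym B_adj -B_sym.
rewrite (adj_quasiprimary hphi (d := d)) //; last by rewrite -hd.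
congr (B _ (Y _ _ _)); lia.
Qed.

Lemma B_word I (U : I -> V) (h : I -> rat) (s : seq (I * rat * nat)) x w :
  (forall i, quasiprimary cs (h i) (U i)) -> admissible h s ->
  B (word VA h U s x) w = B x (word VA h (fun i => g (U i)) (adjoint_word s) w).
Proof.
move=> hU; elim: s w => [|[[i n] k] s IH] w //= /andP [/= ni hs].
have iterB v : B (iter k (mode VA (h i) (U i) n) v) w
    = B v (iter k (mode VA (h i) (g (U i)) (- n)) w).
  elim: k w => //= k IHk w'.
  by rewrite (B_mode _ _ (hU i)) // -iterS iterSr IHk.
rewrite iterB IH // /adjoint_word /= rev_cons.
by rewrite [X in _ = B _ X]/word foldr_rcons.
Qed.

End AnyInvariantForm.
End Form.

Theorem corollary4p7 (R : realType) (V : lmodType R[i]) (VA : vertexAlgebra V)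
    (cs : conformalStructure VA)
    (hV1 : forall v : V, weight cs 1 v -> quasiprimary cs 1 v)
    (phi : V -> V) (hphi : conj_linear_involution cs phi) :
  (exists! B : V -> V -> R[i],
     [/\ hermitian_form B, phi_invariant cs phi B
       & B (vacuum VA) (vacuum VA) = 1]) /\
  (forall B : V -> V -> R[i],
     hermitian_form B -> phi_invariant cs phi B ->
     B (vacuum VA) (vacuum VA) = 1 ->
     forall (I : Type) (U : I -> V) (h : I -> rat),
       (forall i : I, quasiprimary cs (h i) (U i)) ->
       strongly_generates VA U ->
       forall s s' : seq (I * rat * nat),
         admissible h s -> admissible h s' ->
         B (word VA h U s (vacuum VA)) (word VA h U s' (vacuum VA))
         = vev cs
             (word VA h (fun i => gmap cs phi (U i)) (adjoint_word s)
                (word VA h U s' (vacuum VA)))).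
Proof.
split.
  exists (inv_form cs phi); split.
    split; [exact: inv_form_hermitian|exact: inv_form_invariant|exact: inv_form_vac].
  move=> B [Bh Bi B1]; apply/funext => v; apply/funext => u.
  by rewrite (B_eq hphi Bh Bi B1).
move=> B Bh Bi B1 I U h hU _ s s' hs _.
by rewrite (B_word hphi Bh Bi _ _ hU hs) (B_vacl hphi Bh Bi B1).
Qed.
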